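(* Let $f:\mathbb{R}_{\ge0}\to\mathbb{R}$ be a smooth function, let $\mathcal{L}:\mathbb{S}^n\to\mathbb{S}^m$ be a smooth map, and let $F:\mathbb{R}_{\ge0}\times\mathbb{S}^n\to\mathbb{R}^{n+1}\times\mathbb{R}^{m+1}$, $F(r,\mathbf{x})=(r\mathbf{x},f(r)\mathcal{L}(\mathbf{x}))$, and $\Sigma=F(\mathbb{R}_{\ge0}\times\mathbb{S}^n)$. Assume that $f>0$ whenever $r>0$. Then $\Sigma$ is a self-similar solution to the mean curvature flow, i.e. $H_\Sigma=CF^\perp$ where $C=\pm1$, if and only if the following two conditions hold: (1) For each $r\in\mathbb{R}_{>0}$, $\mathcal{L}:(\mathbb{S}^n,g_r)\to(\mathbb{S}^m,g_m)$ is harmonic. (2) For each $r\in\mathbb{R}_{>0}$, $$\Delta_g f-2e_{g_r}(\mathcal{L})f+\frac{C(rf_r-f)}{1+f_r^2}=0\quad\text{in } I_r(\mathbb{S}^n),$$ where $e_{g_r}(\mathcal{L})$ is the energy density of $\mathcal{L}:(\mathbb{S}^n,g_r)\to(\mathbb{S}^m,g_m)$. Moreover, suppose that $\lambda_1,\dots,\lambda_n$ are the singular values of $(\mathcal{L}_* )_{\mathbf{x}}:(T_{\mathbf{x}}\mathbb{S}^n,g_n)\to(T_{\mathcal{L}(\mathbf{x})}\mathbb{S}^m,g_m)$. Then condition (2) is equivalent to the equation $$\frac{f_{rr}}{1+f_r^2}+\sum_{i=1}^n\frac{rf_r-\lambda_i^2f}{r^2+\lambda_i^2f^2}+C(rf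_r-f)=0.$$
   Context: $g_n$, $g_m$ are the standard metrics on the unit spheres $\mathbb{S}^n\subset\mathbb{R}^{n+1}$, $\mathbb{S}^m\subset\mathbb{R}^{m+1}$. $g$ is the metric on $\Sigma$ induced by the standard Euclidean metric on $\mathbb{R}^{n+m+2}$, $I_r:\mathbb{S}^n\to\Sigma$ is $I_r(\mathbf{x})=(r\mathbf{x},f(r)\mathcal{L}(\mathbf{x}))$, and $g_r=I_r^*g$. $\Delta_g$ is the Laplace-Beltrami operator of $(\Sigma,g)$, and $f$ is regarded as a function on $\Sigma$ via $F(r,\mathbf{x})\mapsto f(r)$. Subscript $r$ on $f$ denotes $d/dr$. $H_\Sigma$ is the mean curvature vector of $\Sigma$ (the trace of the second fundamental form with respect to the induced metric) and $F^\perp$ is the projection of the position vector $F$ to the normal bundle of $\Sigma$. A submanifold of Euclidean space is a self-similar solution to the mean curvature flow if $H_\Sigma\equiv CF^\perp$ for some constant $C$. For a smooth map $u:(M,g_M)\to(N,g_N)$ of Riemannian manifolds, the energy density is $e_{g_M}(u)=\frac12\sum_i g_N(u_*e_i,u_*e_i)$ for a $g_M$-orthonormal basis $\{e_i\}$ of the tangent space; $u$ is harmonic if its tension field (the trace with respect to $g_M$ of the second fundamental form of $u$) vanishes identically. Singular values are square roots of the eigenvalues of $((\mathcal{L}_* )_{\mathbf{x}})^*(\mathcal{L}_* )_{\mathbf{x}}$, counted with multiplicity ($n$ of them, zeros included). *)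

(* Defs.v *)
From HB Require Import structures.
From mathcomp Require Import all_boot all_order all_algebra.
From mathcomp Require Import all_classical all_reals all_analysis.

Set Implicit Arguments.
Unset Strict Implicit.
Unset Printing Implicit Defensive.

Import Order.TTheory GRing.Theory Num.Theory.
Import numFieldNormedType.Exports.

Local Open Scope classical_set_scope.
Local Open Scope ring_scope.

(* Vectors are rows and tangent maps act on the right: 'J h u has rows
   'D_(e_i) h u.  The sup norm of 'rV[R]_N is only used for its topology; all
   metric notions are built from the Euclidean inner product [dot]. *)

Section Smoothness.
Variables (R : realType) (V W : normedModType R).

Fixpoint Ck (k : nat) (U : set V) (h : V -> W) : Prop :=
  if k is k'.+1 then
    (forall x, U x -> differentiable h x) /\
    (forall v, Ck k' U (fun x => 'D_v h x))
  else forall x, U x -> {for x, continuous h}.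

(* Smoothness on an arbitrary subset A of V: locally around each point of A, h
   is the restriction of a smooth map defined on an open set of V.  This is
   used for subsets as different as a sphere and the half-line [0, +oo[. *)
Definition smooth_on (A : set V) (h : V -> W) : Prop :=
  forall x, A x -> exists (U : set V) (h' : V -> W),
    [/\ open U, U x, forall k, Ck k U h' &
        forall y, U y -> A y -> h y = h' y].

End Smoothness.

Section LocalGeometry.
Variable R : realType.

Definition dot (N : nat) (x y : 'rV[R]_N) : R := \sum_(i < N) x 0 i * y 0 i.

Definition partial (k : nat) (W : normedModType R) (i : 'I_k)
    (h : 'rV[R]_k -> W) (u : 'rV[R]_k) : W := 'D_(delta_mx 0 i) h u.

(* Pullback by Phi of the Euclidean metric, in the coordinates u. *)
Definition gram (k N : nat) (Phi : 'rV[R]_k -> 'rV[R]_N) (u : 'rV[R]_k)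
  : 'M[R]_k := 'J Phi u *m ('J Phi u)^T.

(* Local parametrizations of the k-dimensional submanifold S of R^N: smooth
   immersions of an open U that are homeomorphisms onto a relatively open
   subset of S.  If S fails to be a submanifold at some of its points, there is
   no parametrization around these points. *)
Definition local_param (k N : nat) (S : set 'rV[R]_N)
    (U : set 'rV[R]_k) (Phi : 'rV[R]_k -> 'rV[R]_N) : Prop :=
  [/\ open U,
      smooth_on U Phi,
      forall u, U u -> row_free ('J Phi u),
      forall u v, U u -> U v -> Phi u = Phi v -> u = v &
      forall V : set 'rV[R]_k, open V -> V `<=` U ->
        exists O : set 'rV[R]_N, open O /\ Phi @` V = S `&` O].

Section Coordinates.
Variable k : nat.

(* G u is the matrix (g_ij) of a Riemannian metric in the coordinates u;
   [christoffel G l i j] is Gamma^l_ij. *)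
Definition christoffel (G : 'rV[R]_k -> 'M[R]_k) (l i j : 'I_k)
    (u : 'rV[R]_k) : R :=
  2^-1 * \sum_(s < k) invmx (G u) l s *
    (partial i (fun v => G v j s) u + partial j (fun v => G v i s) u
     - partial s (fun v => G v i j) u).

Definition trace_metric (W : lmodType R) (g : 'M[R]_k)
    (B : 'I_k -> 'I_k -> W) : W :=
  \sum_(i < k) \sum_(j < k) invmx g i j *: B i j.

(* Trace of the covariant Hessian. *)
Definition laplace_beltrami (G : 'rV[R]_k -> 'M[R]_k) (h : 'rV[R]_k -> R^o)
    (u : 'rV[R]_k) : R :=
  trace_metric (G u) (fun i j =>
    partial i (partial j h) u
    - \sum_(l < k) christoffel G l i j u *: partial l h u).

(* Projection of R^m.+1 onto the tangent space of the unit sphere at y. *)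
Definition sphere_tangent (m : nat) (y v : 'rV[R]_m.+1) : 'rV[R]_m.+1 :=
  v - dot v y *: y.

(* Trace of the second fundamental form
     (nabla dw)(d_i, d_j) = nabla_{d_i} (dw(d_j)) - dw(nabla_{d_i} d_j)
   of a map w into the unit sphere of R^m.+1, whose Levi-Civita connection is
   the tangential part of the flat derivative of R^m.+1. *)
Definition tension (m : nat) (G : 'rV[R]_k -> 'M[R]_k)
    (w : 'rV[R]_k -> 'rV[R]_m.+1) (u : 'rV[R]_k) : 'rV[R]_m.+1 :=
  trace_metric (G u) (fun i j =>
    sphere_tangent (w u) (partial i (partial j w) u)
    - \sum_(l < k) christoffel G l i j u *: partial l w u).

(* Orthogonal projection of R^N onto the complement of the row space of J. *)
Definition normal_proj (N : nat) (J : 'M[R]_(k, N)) (v : 'rV[R]_N)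
  : 'rV[R]_N :=
  v - v *m J^T *m invmx (J *m J^T) *m J.

(* Trace of the second fundamental form, which on a parametrized submanifold
   is the normal part of the second derivatives. *)
Definition mean_curvature (N : nat) (Psi : 'rV[R]_k -> 'rV[R]_N)
    (u : 'rV[R]_k) : 'rV[R]_N :=
  trace_metric (gram Psi u) (fun i j =>
    normal_proj ('J Psi u) (partial i (partial j Psi) u)).

End Coordinates.

(* In the definitions below, S is a k-dimensional submanifold of R^N. *)

Definition self_similar (k N : nat) (S : set 'rV[R]_N) (C : R) : Prop :=
  forall (U : set 'rV[R]_k) (Psi : 'rV[R]_k -> 'rV[R]_N),
    local_param S U Psi ->
    forall u, U u ->
      mean_curvature Psi u = C *: normal_proj ('J Psi u) (Psi u).

(* v is the value at p of the Laplace-Beltrami operator, for the induced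
   metric of S, applied to h. *)
Definition laplacian_at (k N : nat) (S : set 'rV[R]_N) (h : 'rV[R]_N -> R)
    (p : 'rV[R]_N) (v : R) : Prop :=
  exists (U : set 'rV[R]_k) (Psi : 'rV[R]_k -> 'rV[R]_N) (u : 'rV[R]_k),
    [/\ local_param S U Psi, U u, Psi u = p &
        v = laplace_beltrami (gram Psi) (h \o Psi) u].

(* w : (S, I^* eucl) -> (S^m, standard metric) is harmonic. *)
Definition harmonic (k N N' m : nat) (S : set 'rV[R]_N)
    (I : 'rV[R]_N -> 'rV[R]_N') (w : 'rV[R]_N -> 'rV[R]_m.+1) : Prop :=
  forall (U : set 'rV[R]_k) (Phi : 'rV[R]_k -> 'rV[R]_N),
    local_param S U Phi ->
    forall u, U u -> tension (gram (I \o Phi)) (w \o Phi) u = 0.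

(* e is the energy density at x of w : (S, I^* eucl) -> (S^m, standard metric).
   The rows of E are the coordinates, in the basis (d_i Phi), of an
   orthonormal basis of the tangent space. *)
Definition energy_density_at (k N N' m : nat) (S : set 'rV[R]_N)
    (I : 'rV[R]_N -> 'rV[R]_N') (w : 'rV[R]_N -> 'rV[R]_m.+1)
    (x : 'rV[R]_N) (e : R) : Prop :=
  exists (U : set 'rV[R]_k) (Phi : 'rV[R]_k -> 'rV[R]_N) (u : 'rV[R]_k)
         (E : 'M[R]_k),
    [/\ local_param S U Phi, U u, Phi u = x,
        E *m gram (I \o Phi) u *m E^T = 1%:M &
        e = 2^-1 * \sum_(i < k) dot (row i E *m 'J (w \o Phi) u)
                                    (row i E *m 'J (w \o Phi) u)].

(* lam lists the singular values of the differential dw at x, for the induced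
   metric on S and the standard metric on S^m.  In the basis (d_i Phi), the
   composite T of dw and its adjoint is given by the matrix M such that
   M *m gram Phi u = gram (w \o Phi) u, because <T a, b> = <dw a, dw b>. *)
Definition singular_values_at (k N m : nat) (S : set 'rV[R]_N)
    (w : 'rV[R]_N -> 'rV[R]_m.+1) (x : 'rV[R]_N) (lam : 'I_k -> R) : Prop :=
  exists (U : set 'rV[R]_k) (Phi : 'rV[R]_k -> 'rV[R]_N) (u : 'rV[R]_k),
    [/\ local_param S U Phi, U u, Phi u = x,
        forall i, 0 <= lam i &
        char_poly (gram (w \o Phi) u *m invmx (gram Phi u))
        = \prod_(i < k) ('X - (lam i ^+ 2)%:P)].

End LocalGeometry.

Section SphericalGraph.
Variables (R : realType) (n m : nat).

Definition sphere (N : nat) : set 'rV[R]_N.+1 := [set x | dot x x = 1].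

Variables (f : R -> R) (L : 'rV[R]_n.+1 -> 'rV[R]_m.+1).

(* The map F of the pair (r, x), so that [graphF r] is I_r. *)
Definition graphF (r : R) (x : 'rV[R]_n.+1) : 'rV[R]_(n.+1 + m.+1) :=
  row_mx (r *: x) (f r *: L x).

Definition Sigma : set 'rV[R]_(n.+1 + m.+1) :=
  [set p | exists r x, [/\ 0 <= r, sphere x & p = graphF r x]].

(* f as a function on Sigma; see [f_SigmaE]. *)
Definition f_Sigma (p : 'rV[R]_(n.+1 + m.+1)) : R :=
  f (Num.sqrt (dot (lsubmx p) (lsubmx p))).

Lemma f_SigmaE (r : R) (x : 'rV[R]_n.+1) :
  0 <= r -> sphere x -> f_Sigma (graphF r x) = f r.
Proof.
move=> r0 xS; rewrite /f_Sigma row_mxKl; congr f.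
suff -> : dot (r *: x) (r *: x) = r ^+ 2 by rewrite sqrtr_sqr ger0_norm.
rewrite -[RHS]mulr1 -[in RHS](xS : dot x x = 1) /dot mulr_sumr.
by apply: eq_bigr => i _; rewrite !mxE mulrACA expr2.
Qed.

Definition harmonic_condition : Prop :=
  forall r : R, 0 < r -> harmonic n (@sphere n) (graphF r) L.

Definition laplace_condition (C : R) : Prop :=
  forall r : R, 0 < r -> forall x, sphere x ->
  forall lap e : R,
    laplacian_at n.+1 Sigma f_Sigma (graphF r x) lap ->
    energy_density_at n (@sphere n) (graphF r) L x e ->
    lap - 2 * e * f r + C * (r * f^`()%classic r - f r) / (1 + f^`()%classic r ^+ 2) = 0.

End SphericalGraph.

(* Main.v *)
Require Import Defs.
From HB Require Import structures.
From mathcomp Require Import all_boot all_order all_algebra.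
From mathcomp Require Import all_classical all_reals all_analysis.
From mathcomp Require Import ring.

Set Implicit Arguments.
Unset Strict Implicit.
Unset Printing Implicit Defensive.

Import Order.TTheory GRing.Theory Num.Theory.
Import numFieldNormedType.Exports.

Local Open Scope classical_set_scope.
Local Open Scope ring_scope.

(** Write x for a point of the source sphere, y = L x, and alpha, 2e for the
    traces with respect to g_r of the standard metric of the source and of the
    pulled-back metric of the target; e is the energy density.

    All the second order operators at stake are one operator.  For an immersion
    Psi with metric g and a vector-valued function W, put
      lap Psi W = tr_g (D^2 W) - dW (T),
    where T is the tangential part of tr_g (D^2 Psi).  By the formula of Gauss,
    which computes Christoffel symbols from second derivatives of Psi
    ([christoffel_gram]), T is the trace of the Christoffel symbols.  Hence
    lap Psi Psi is the mean curvature vector, lap Psi h is the Laplacian of a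
    function h, and the tension of a map w into a sphere is the tangential part
    of lap Psi w.  The chain rule makes lap independent of the coordinates
    ([lap_comp]).

    Off the axis {r = 0}, Sigma is the graph of z |-> f |z| L (z / |z|) over
    R^(n+1) minus 0.  Composing a parametrization Psi of Sigma with the
    projection to R^(n+1) gives a smooth local diffeomorphism phi, and
    Psi = graph o phi.  So every coordinate expression on Sigma is carried to
    the graph, and from the graph to the polar coordinates
    (t, u) |-> (t Phi(u), f(t) w(u)), where Phi is a chart of the sphere and
    w = L o Phi.

    There the metric is the orthogonal sum of (1 + f_r^2) dt^2 and g_r, and
    [lap_cylF] separates the radial derivatives from lap on the slice.  Let A
    and B be the images of Phi and w under lap on the slice {t = r}.
    Differentiating |Phi| = |w| = 1 twice gives <A, x> = - alpha and
    <B, y> = - 2e.  The second component of H = C F^perp has a part orthogonal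
    to y, which is B + 2e y = 0, that is, harmonicity of L; its part along y is
    the Laplace equation for f.  Conversely, if B = - 2e y, then (r A, f B), being normal
    to the slice, forces A = - alpha x, and what remains of the first component
    is - f_r times the Laplace equation.  This is [normal_splitting].

    A parametrization of Sigma may also pass through the axis.  It maps open
    sets to relatively open sets of Sigma, and these contain points with r > 0,
    so H = C F^perp extends by continuity ([self_similar_graph]).

    For the last assertion, lap of f on the graph is computed in polar
    coordinates, and the Laplace equation becomes, up to the factor 1 + f_r^2,
      f_rr / (1 + f_r^2) + r f_r alpha - 2e f + C (r f_r - f) = 0.
    If M represents the composite of dL with its adjoint, then
    alpha = tr (r^2 + f^2 M)^-1 and r^2 alpha + 2e f^2 = n, and the trace of an
    inverse is read off from the characteristic polynomial of M
    ([trace_inv_affine]). *)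

(** * Directional derivatives *)

Section Differentiation.
Variable R : realType.
Implicit Types U V W : normedModType R.

Lemma derive_comp U V W (h : U -> V) (g : V -> W) x v :
  differentiable h x -> differentiable g (h x) ->
  'D_v (g \o h) x = 'D_('D_v h x) g (h x).
Proof.
by move=> dh dg; rewrite !deriveE//; [rewrite diff_comp|exact: differentiable_comp].
Qed.

Lemma near_eq_differentiable V W (h g : V -> W) x :
  (\forall y \near x, h y = g y) -> differentiable h x -> differentiable g x.
Proof.
move=> hg dh.
have e : g \o shift x = cst (g x) + 'd h x +o_ 0 id.
  apply/eqaddoP => e e0; have /eqaddoP/(_ e e0) := diff_locally dh.
  have : \forall y \near (0 : V), h (y + x) = g (y + x).
    move: hg; rewrite (near_shift 0) ; apply: filterS => y /=.
    by rewrite subr0.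
  apply: filterS2 => y E.
  rewrite -[X in `|X| <= _ -> _]/(h (y + x) - (h x + 'd h x y)).
  rewrite -[X in _ -> `|X| <= _]/(g (y + x) - (g x + 'd h x y)).
  by rewrite E (nbhs_singleton hg).
apply/diff_locallyP; rewrite (diff_unique _ e); first by split => //; apply: diff_continuous.
exact: diff_continuous.
Qed.

Lemma scale_is_bilinear W :
  bilinear_for
    (GRing.Scale.Law.clone _ _ *:%R _) (GRing.Scale.Law.clone _ _ *:%R _)
    (@GRing.scale R W).
Proof.
split=> [u'|u] a x y /=.
- by rewrite scalerDl scalerA.
- by rewrite scalerDr !scalerA mulrC.
Qed.

Lemma is_diff_scale V W (a : V -> R) (h : V -> W) x :
  differentiable a x -> differentiable h x ->
  is_diff x (fun y => a y *: h y) (fun v => a x *: 'd h x v + 'd a x v *: h x).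
Proof.
move=> da dh.
pose bM := bilinear_isBilinear.Build R R W W _ _ (@GRing.scale R W) (scale_is_bilinear W).
pose b : {bilinear R -> W -> W} := HB.pack (@GRing.scale R W) bM.
have bc : continuous (fun p : R * W => b p.1 p.2) by exact: scale_continuous.
have dp : is_diff (a x, h x) (fun p : R * W => b p.1 p.2)
   (fun q : R * W => b (a x) q.2 + b q.1 (h x)).
  by apply: DiffDef; [exact: differentiable_bilin|rewrite (diff_bilin _ bc)].
have := @is_diff_comp _ _ _ _ (fun y => (a y, h y)) (fun v => ('d a x v, 'd h x v)) _ _ x _ dp.
apply.
apply: is_diff_pair; exact: differentiableP.
Qed.

Lemma differentiable_scale V W (a : V -> R) (h : V -> W) x :
  differentiable a x -> differentiable h x ->
  differentiable (fun y => a y *: h y) x.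
Proof. by move=> da dh; have [] := is_diff_scale da dh. Qed.

Lemma derive_scale V W (a : V -> R) (h : V -> W) x v :
  differentiable a x -> differentiable h x ->
  'D_v (fun y => a y *: h y) x = 'D_v a x *: h x + a x *: 'D_v h x.
Proof.
move=> da dh; have [d e] := is_diff_scale da dh.
by rewrite !deriveE// e addrC.
Qed.

Lemma derive_lin V W W' (l : {linear W -> W'}) (h : V -> W) x v :
  continuous l -> differentiable h x ->
  'D_v (l \o h) x = l ('D_v h x).
Proof.
move=> lc dh; rewrite derive_comp//; last exact: linear_differentiable.
by rewrite deriveE ?diff_lin//; exact: linear_differentiable.
Qed.

End Differentiation.

(** * Maps of class C^k *)
Section CkCalculus.
Variable R : realType.
Implicit Types V W : normedModType R.

Lemma Ck_cst V W k (U : set V) (w : W) : Ck k U (cst w).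
Proof.
elim: k w => [|k IH] w /=; first by move=> x _; exact: cst_continuous.
split=> [x _|v]; first exact: differentiable_cst.
have -> : (fun x => 'D_v (cst w) x) = cst (0 : W) by apply/funext => x; rewrite derive_cst.
exact: IH.
Qed.

Lemma CkS V W k (U : set V) (h : V -> W) : Ck k.+1 U h -> Ck k U h.
Proof.
elim: k h => [|k IH] h [dh Dh]; first by move=> x /dh /differentiable_continuous.
by split=> // v; apply/IH/Dh.
Qed.

Lemma Ck_sub V W k (U U' : set V) (h : V -> W) : U' `<=` U -> Ck k U h -> Ck k U' h.
Proof.
move=> sU; elim: k h => [|k IH] h /=; first by move=> hc x /sU; apply: hc.
by move=> [dh Dh]; split=> [x /sU|v]; [apply: dh|apply/IH/Dh].
Qed.

Lemma Ck_local V W k (U : set V) (h : V -> W) :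
  (forall x, U x -> exists2 U', open_nbhs x U' & Ck k U' h) -> Ck k U h.
Proof.
elim: k h => [|k IH] h H /=.
  by move=> x /H[U' [_ xU']]; apply.
split=> [x Ux|v].
  by have [U' [_ xU'] [dh _]] := H x Ux; exact: dh.
by apply: IH => x /H[U' oU' [_ Dh]]; exists U'; last exact: Dh.
Qed.

Lemma Ck_eq V W k (U : set V) (h g : V -> W) : open U ->
  (forall x, U x -> h x = g x) -> Ck k U h -> Ck k U g.
Proof.
move=> oU; elim: k h g => [|k IH] h g hg /=; have near_hg x : U x -> \forall y \near x, h y = g y.
- by move=> Ux; apply: filterS (open_nbhs_nbhs (conj oU Ux)) => y /hg.
- move=> hc x Ux; have := hc x Ux.
  rewrite /prop_for /continuous_at (hg x Ux); apply: cvg_trans.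
  by apply: near_eq_cvg; exact: near_hg.
- by move=> Ux; apply: filterS (open_nbhs_nbhs (conj oU Ux)) => y /hg.
move=> [dh Dh]; split=> [x Ux|v].
  by apply: near_eq_differentiable (near_hg x Ux) (dh x Ux).
by apply: IH (Dh v) => x Ux; exact/near_eq_derive/near_hg.
Qed.

Lemma CkD V W k (U : set V) (h g : V -> W) : open U ->
  Ck k U h -> Ck k U g -> Ck k U (h \+ g).
Proof.
move=> oU; elim: k h g => [|k IH] h g /=.
  by move=> hc gc x Ux; apply: continuousD; [exact: hc|exact: gc].
move=> [dh Dh] [dg Dg]; split=> [x Ux|v].
  by apply: differentiableD; [exact: dh|exact: dg].
apply: Ck_eq (IH _ _ (Dh v) (Dg v)) => //= x Ux.
by rewrite -deriveD//; apply: diff_derivable; [exact: dh|exact: dg].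
Qed.

Lemma Ck_scale V W k (U : set V) (a : V -> R) (h : V -> W) : open U ->
  Ck k U (a : V -> R^o) -> Ck k U h -> Ck k U (fun x => a x *: h x).
Proof.
move=> oU; elim: k a h => [|k IH] a h.
  by move=> ac hc x Ux; apply: continuousZ; [exact: ac|exact: hc].
move=> aC hC; have [[da Da] [dh Dh]] := (aC, hC); split=> [x Ux|v].
  by apply: differentiable_scale; [exact: da|exact: dh].
apply: Ck_eq (CkD oU (IH _ _ (Da v) (CkS hC)) (IH _ _ (CkS aC) (Dh v))) => //= x Ux.
by rewrite derive_scale//; [exact: da|exact: dh].
Qed.

Lemma Ck_lin V W W' k (U : set V) (l : {linear W -> W'}) (h : V -> W) :
  open U -> continuous l -> Ck k U h -> Ck k U (l \o h).
Proof.
move=> oU lc; elim: k h => [|k IH] h.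
  by move=> hc x Ux; apply: continuous_comp; [exact: hc|exact: lc].
move=> [dh Dh]; split=> [x Ux|v].
  by apply: differentiable_comp; [exact: dh|exact: linear_differentiable].
by apply: Ck_eq (IH _ (Dh v)) => //= x Ux; rewrite derive_lin//; exact: dh.
Qed.

Lemma Ck_sum V W k (U : set V) (I : Type) (s : seq I) (h : I -> V -> W) : open U ->
  (forall i, Ck k U (h i)) -> Ck k U (fun x => \sum_(i <- s) h i x).
Proof.
move=> oU hC; elim: s => [|i s IH].
  by apply: Ck_eq (Ck_cst k U (0 : W)) => // x _; rewrite big_nil.
by apply: Ck_eq (CkD oU (hC i) IH) => // x _; rewrite big_cons.
Qed.

(** The derivative of g o h in a direction v is the sum of the derivatives of g
    in the directions of a basis, weighted by the coordinates of the derivative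
    of h, so that sums and products suffice for the induction on k.  A finite
    basis of the middle space is a parameter because both row vectors and
    scalars occur there. *)
Lemma Ck_comp_basis V V' W p (e : 'I_p -> V') (c : 'I_p -> {linear V' -> R^o})
    k (U : set V) (U' : set V') (h : V -> V') (g : V' -> W) :
  (forall i, continuous (c i)) -> (forall v, v = \sum_i c i v *: e i) ->
  open U -> (forall x, U x -> U' (h x)) ->
  Ck k U h -> Ck k U' g -> Ck k U (g \o h).
Proof.
move=> cc ce oU UU'; elim: k h g UU' => [|k IH] h g UU'.
  by move=> hc gc x Ux; apply: continuous_comp; [exact: hc|exact: gc (UU' _ Ux)].
move=> hC [dg Dg]; have [dh Dh] := hC; split=> [x Ux|v].
  by apply: differentiable_comp; [exact: dh|exact: dg (UU' _ Ux)].
have C1 i : Ck k U (fun x => c i ('D_v h x) *: 'D_(e i) g (h x)).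
  apply: Ck_scale => //; first by apply: (Ck_lin oU (cc i) (Dh v)).
  by apply: (IH h (fun y => 'D_(e i) g y)) => //; [exact: CkS|exact: Dg].
apply: Ck_eq (Ck_sum (index_enum 'I_p) oU C1) => // x Ux.
rewrite derive_comp; [|exact: dh|exact: dg (UU' _ Ux)].
rewrite [in RHS](ce ('D_v h x)) (@deriveE _ _ _ g); last exact: dg (UU' _ Ux).
rewrite linear_sum; apply: eq_bigr => i _.
by rewrite linearZ/= (@deriveE _ _ _ g)//; exact: dg (UU' _ Ux).
Qed.

End CkCalculus.

Section SmoothMaps.
Variable R : realType.
Implicit Types V W : normedModType R.

(** A named function, so that the linear structure can be attached to it. *)
Definition coordmx n m (i : 'I_n) (j : 'I_m) (A : 'M[R]_(n, m)) : R^o := A i j.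

Lemma coordmx_is_linear n m (i : 'I_n) (j : 'I_m) : linear (coordmx i j).
Proof. by move=> a A B; rewrite /coordmx !mxE. Qed.
HB.instance Definition _ n m (i : 'I_n) (j : 'I_m) :=
  GRing.isLinear.Build _ _ _ _ (coordmx i j) (coordmx_is_linear i j).

Lemma Ck_comp_rV p V W k (U : set V) (U' : set 'rV[R]_p) (h : V -> 'rV[R]_p)
    (g : 'rV[R]_p -> W) :
  open U -> (forall x, U x -> U' (h x)) ->
  Ck k U h -> Ck k U' g -> Ck k U (g \o h).
Proof.
apply: (@Ck_comp_basis _ _ _ _ p (fun i => delta_mx 0 i)
  (fun i => coordmx 0 i)).
- by move=> i; exact: coord_continuous.
- by move=> v; exact: row_sum_delta.
Qed.

Lemma Ck_comp_R V W k (U : set V) (U' : set R) (h : V -> R^o) (g : R^o -> W) :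
  open U -> (forall x, U x -> U' (h x)) ->
  Ck k U h -> Ck k U' g -> Ck k U (g \o h).
Proof.
apply: (@Ck_comp_basis _ _ _ _ 1 (fun _ => 1 : R^o)
  (fun i => idfun : {linear R^o -> R^o})).
- by move=> _ x; apply: cvg_id.
- by move=> v; rewrite big_ord1 /= [_ *: _]mulr1.
Qed.

Lemma Ck_id V k (U : set V) : Ck k U (id : V -> V).
Proof.
case: k => [|k] /=; first by move=> x _; apply: cvg_id.
split=> [x _|v]; first exact: ex_diff.
rewrite [X in Ck _ _ X](_ : _ = cst v); first exact: Ck_cst.
by apply/funext => x; rewrite derive_id.
Qed.

Lemma CkM V k (U : set V) (a b : V -> R^o) : open U ->
  Ck k U a -> Ck k U b -> Ck k U (fun x => a x * b x : R^o).
Proof. exact: Ck_scale. Qed.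

Lemma Ck_coord V n m k (U : set V) (h : V -> 'M[R]_(n, m)) i j :
  open U -> Ck k U h -> Ck k U (fun x => h x i j : R^o).
Proof.
move=> oU hC; apply: (Ck_lin (l := coordmx i j) oU _ hC).
exact: coord_continuous.
Qed.

Lemma Ck_mx V n m k (U : set V) (h : V -> 'M[R]_(n, m)) :
  open U -> (forall i j, Ck k U (fun x => h x i j : R^o)) -> Ck k U h.
Proof.
move=> oU hC.
have C2 i : Ck k U (fun x => \sum_j h x i j *: (delta_mx i j : 'M[R]_(n, m))).
  by apply: Ck_sum => // j; apply: Ck_scale => //; exact: Ck_cst.
apply: Ck_eq (Ck_sum (index_enum 'I_n) oU C2) => // x _.
by rewrite -matrix_sum_delta.
Qed.

Lemma Ck_scalec V W k (U : set V) (c : R) (h : V -> W) :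
  open U -> Ck k U h -> Ck k U (fun x => c *: h x).
Proof. by move=> oU; exact: (Ck_scale oU (Ck_cst k U (c : R^o))). Qed.

Lemma Ck_scaler V W k (U : set V) (a : V -> R) (y : W) :
  open U -> Ck k U (a : V -> R^o) -> Ck k U (fun x => a x *: y).
Proof. by move=> oU aC; exact: (Ck_scale oU aC (Ck_cst k U y)). Qed.

Lemma Ck_partial n W k (U : set 'rV[R]_n)
    (h : 'rV[R]_n -> W) i :
  Ck k.+1 U h -> Ck k U (partial i h).
Proof. by case=> _; exact. Qed.


Lemma CkN V W k (U : set V) (h : V -> W) : open U -> Ck k U h -> Ck k U (fun x => - h x).
Proof.
move=> oU hC; have := Ck_scale oU (Ck_cst k U (-1 : R^o)) hC.
by apply: Ck_eq => // x _; rewrite scaleN1r.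
Qed.

Lemma Ck_inv k : Ck k [set x : R^o | x != 0] (GRing.inv : R^o -> R^o).
Proof.
have oU : open [set x : R^o | x != 0] by exact: open_neq.
elim: k => [|k IH] /=; first by move=> x x0; exact: inv_continuous.
split=> [x x0|v]; first exact: differentiable_Rinv.
have C := CkM oU (Ck_cst k _ (- v : R^o)) (CkM oU IH IH).
apply: Ck_eq C => // x x0.
rewrite deriveE; last exact: differentiable_Rinv.
rewrite (diff_Rinv x0) /= -[_ *: v]/(_ * v) expr2 invfM.
by rewrite !mulNr mulrC.
Qed.

Lemma Ck_sqrt k : Ck k [set x : R^o | 0 < x] (Num.sqrt : R^o -> R^o).
Proof.
have oU : open [set x : R^o | 0 < x] by exact: open_gt.
have dsqrt (x : R) : 0 < x -> differentiable (Num.sqrt : R^o -> R^o) x.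
  by move=> x0; apply/derivable1_diffP; have [] := is_derive1_sqrt x0.
elim: k => [|k IH]; first by move=> x _; exact: sqrt_continuous.
split=> [x x0|v]; first exact: dsqrt.
have C2 : Ck k [set x : R^o | 0 < x] (fun x => 2 * Num.sqrt x : R^o).
  by apply: CkM => //; exact: Ck_cst.
have C := Ck_comp_R (U' := [set x : R^o | x != 0]) oU _ C2 (@Ck_inv k).
have {}C := CkM oU (Ck_cst k _ (v : R^o)) (C _).
apply: Ck_eq (C _) => //.
- move=> x x0 /=.
  rewrite -[in RHS](mulr1 v) deriveE; last exact: dsqrt.
  rewrite [in RHS]linearZ -deriveE; last exact: dsqrt.
  by have -> := @derive_val _ _ _ _ _ _ _ (is_derive1_sqrt x0).
by move=> x x0 /=; rewrite mulf_neq0// gt_eqF ?sqrtr_gt0.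
Qed.

Lemma Ck_dot V N k (U : set V) (h g : V -> 'rV[R]_N) : open U ->
  Ck k U h -> Ck k U g -> Ck k U (fun x => dot (h x) (g x) : R^o).
Proof.
by move=> oU hC gC; apply: Ck_sum => // i; apply: CkM => //; exact: Ck_coord.
Qed.

Lemma Ck_row_mx V n m k (U : set V) (h : V -> 'rV[R]_n) (g : V -> 'rV[R]_m) : open U ->
  Ck k U h -> Ck k U g -> Ck k U (fun x => row_mx (h x) (g x)).
Proof.
move=> oU hC gC; apply: Ck_mx => // i j.
case: (split_ordP j) => j' ->.
- by apply: Ck_eq (Ck_coord i j' oU hC) => // x _; rewrite row_mxEl.
- by apply: Ck_eq (Ck_coord i j' oU gC) => // x _; rewrite row_mxEr.
Qed.

Lemma Ck_mulmx V n m p k (U : set V) (h : V -> 'M[R]_(n, m)) (g : V -> 'M[R]_(m, p)) :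
  open U -> Ck k U h -> Ck k U g -> Ck k U (fun x => h x *m g x).
Proof.
move=> oU hC gC; apply: Ck_mx => // i j.
have C l : Ck k U (fun x => h x i l * g x l j : R^o) by apply: CkM => //; exact: Ck_coord.
by apply: Ck_eq (Ck_sum (index_enum 'I_m) oU C) => // x _; rewrite mxE.
Qed.

Lemma Ck_trmx V n m k (U : set V) (h : V -> 'M[R]_(n, m)) :
  open U -> Ck k U h -> Ck k U (fun x => (h x)^T).
Proof.
move=> oU hC; apply: Ck_mx => // i j.
by apply: Ck_eq (Ck_coord j i oU hC) => // x _; rewrite mxE.
Qed.

(** On an open set the local extensions are the map itself. *)
Lemma smooth_on_open V W (U : set V) (h : V -> W) k :
  open U -> smooth_on U h -> Ck k U h.
Proof.
move=> oU hC; apply: Ck_local => x Ux.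
have [U1 [h1 [oU1 U1x C1 e]]] := hC x Ux.
have oI : open (U1 `&` U) by exact: openI.
exists (U1 `&` U) => //.
apply: Ck_eq (Ck_sub (@subIsetl _ _ _) (C1 k)) => // y [U1y Uy].
by rewrite e.
Qed.

Lemma Ck_smooth_on V W (U : set V) (h : V -> W) :
  open U -> (forall k, Ck k U h) -> smooth_on U h.
Proof. by move=> oU hC x Ux; exists U, h; split. Qed.

Lemma Ck_jacobian p q k (U : set 'rV[R]_p) (h : 'rV[R]_p -> 'rV[R]_q) :
  open U -> Ck k.+1 U h -> Ck k U (fun x => 'J h x).
Proof.
move=> oU [dh Dh]; apply: Ck_mx => // i j.
apply: Ck_eq (Ck_coord 0 j oU (Dh (delta_mx 0 i))) => // x Ux.
by rewrite deriveEjacobian; [rewrite -rowE mxE|exact: dh].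
Qed.

Lemma jacobian_row p q (h : 'rV[R]_p -> 'rV[R]_q) u i :
  differentiable h u -> row i ('J h u) = partial i h u.
Proof. by move=> dh; rewrite /partial deriveEjacobian// rowE. Qed.

End SmoothMaps.

(** * Symmetry of second derivatives *)
Section Schwarz.
Variables (R : realType) (V : normedModType R).

Lemma is_derive_line (W : normedModType R) (g : V -> W) (p v : V) (s : R) :
  differentiable g (p + s *: v) ->
  is_derive s 1 (fun s : R => g (p + s *: v)) ('D_v g (p + s *: v)).
Proof.
move=> dg.
have dl : differentiable (fun s : R => p + s *: v) s.
  by apply: differentiableD => //; exact: differentiableZl.
apply: DeriveDef.
  by apply: diff_derivable; exact: (@differentiable_comp _ _ _ _ _ g).
rewrite (@derive_comp _ _ _ _ (fun s : R => p + s *: v) g)//; congr ('D_ _ g _).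
rewrite deriveD//; last first.
  by apply: diff_derivable; exact: differentiableZl.
rewrite derive_cst add0r deriveE; last exact: differentiableZl.
by rewrite (@diffZl _ _ _ id v s)//= diff_val scale1r.
Qed.

Lemma mean_value_line (g : V -> R^o) (p v : V) (e : R) : 0 < e ->
  (forall s, 0 <= s <= e -> differentiable g (p + s *: v)) ->
  exists2 c, 0 < c < e & g (p + e *: v) - g p = e * 'D_v g (p + c *: v).
Proof.
move=> e0 dg.
have [] := @MVT R (fun s : R => g (p + s *: v)) (fun s => 'D_v g (p + s *: v)) 0 e e0.
- move=> s; rewrite in_itv/= => /andP[/ltW s0 /ltW se]; apply: is_derive_line.
  by apply: dg; rewrite s0 se.
- apply: derivable_within_continuous => s; rewrite in_itv/= => /dg dgs.
  by have [] := is_derive_line dgs.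
move=> c; rewrite in_itv/= => ce; rewrite scale0r addr0 subr0 mulrC => E.
by exists c.
Qed.

Lemma derive_shiftv (W : normedModType R) (g : V -> W) (a v x : V) :
  'D_v (g \o shift a) x = 'D_v g (x + a).
Proof.
by rewrite /derive; under eq_fun do rewrite /= -addrA.
Qed.

Lemma subrBB_swap (Z : zmodType) (a b c d : Z) : a - b - (c - d) = a - c - (b - d).
Proof.
by rewrite !opprB addrACA [RHS]addrACA [- b - c]addrC.
Qed.

(** Two applications of the mean value theorem: first to h(. + e w) - h in the
    direction v, then to the derivative of h along v in the direction w. *)
Lemma second_difference (h : V -> R^o) (U : set V) (x v w : V) (e : R) :
  0 < e -> Ck 2 U h ->
  (forall s t, 0 <= s <= e -> 0 <= t <= e -> U (x + s *: v + t *: w)) ->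
  exists c d, [/\ 0 < c < e, 0 < d < e &
    h (x + e *: v + e *: w) - h (x + e *: v) - (h (x + e *: w) - h x) =
    e * (e * 'D_w (fun y => 'D_v h y) (x + c *: v + d *: w))].
Proof.
move=> e0 [dh Dh] box.
have ee : 0 <= e <= e by rewrite lexx ltW.
have z0 : (0 : R) <= 0 <= e by rewrite lexx ltW.
have dshift s : 0 <= s <= e -> differentiable (h \o shift (e *: w)) (x + s *: v).
  move=> se; apply: differentiable_comp; last exact/dh/box.
  by apply: differentiableD.
have dns s : 0 <= s <= e -> differentiable h (x + s *: v).
  by move=> se; have := dh _ (box s 0 se z0); rewrite scale0r addr0.
have [] := @mean_value_line ((h \o shift (e *: w)) - h) x v e e0.
  by move=> s se; apply: differentiableB; [exact: dshift|exact: dns].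
move=> c ce E; have ce' : 0 <= c <= e by case/andP: ce => /ltW-> /ltW->.
have [dDh _] := Dh v.
have [] := @mean_value_line (fun y => 'D_v h y) (x + c *: v) w e e0.
  by move=> t te; apply/dDh/box.
move=> d de E2; exists c, d; split => //.
rewrite -E2; move: E.
rewrite -![((_ - _ : _ -> _) _)]/(_ - _) /= => E.
have -> : h (x + e *: v + e *: w) - h (x + e *: v) - (h (x + e *: w) - h x) =
   e * 'D_v (h \o shift (e *: w) - h) (x + c *: v) by [].
congr (_ * _).
rewrite deriveB; [|exact/diff_derivable/dshift|exact/diff_derivable/dns].
by congr (_ - _); rewrite derive_shiftv addrAC.
Qed.

(** The second difference of [second_difference] is symmetric in v and w, so the
    two mixed derivatives agree at two points that tend to x with the step. *)
Theorem derive_comm (h : V -> R^o) (U : set V) (x v w : V) :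
  open_nbhs x U -> Ck 2 U h ->
  'D_w (fun y => 'D_v h y) x = 'D_v (fun y => 'D_w h y) x.
Proof.
move=> [oU Ux] hC; have [dh Dh] := hC.
pose A : V -> R := fun y => 'D_w (fun y => 'D_v h y) y.
pose B : V -> R := fun y => 'D_v (fun y => 'D_w h y) y.
have Ac : {for x, continuous A} by have [_ /(_ w) Dhv] := Dh v; exact: (Dhv x Ux).
have Bc : {for x, continuous B} by have [_ /(_ v) Dhw] := Dh w; exact: (Dhw x Ux).
suff AB0 : A x = B x by exact: AB0.
apply/eqP; rewrite -subr_eq0 -normr_le0; apply/ler_addgt0Pl => e e0.
rewrite addr0.
have e2 : 0 < e / 2 by rewrite divr_gt0.
have : \forall y \near x, [/\ U y, `|A x - A y| < e / 2 & `|B x - B y| < e / 2].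
  have nU : \forall y \near x, U y by exact: open_nbhs_nbhs.
  have nA : \forall y \near x, `|A x - A y| < e / 2.
    by move/cvgrPdist_lt : Ac => /(_ _ e2).
  have nB : \forall y \near x, `|B x - B y| < e / 2.
    by move/cvgrPdist_lt : Bc => /(_ _ e2).
  by apply: filterS3 nU nA nB => y.
move=> /nbhs_normP[/= r r0 rP].
pose k := `|v| + `|w| + 1.
have k0 : 0 < k by rewrite ltr_wpDl// addr_ge0.
pose d := r / k / 2.
have d0 : 0 < d by rewrite !divr_gt0.
have box s t : 0 <= s <= d -> 0 <= t <= d ->
  [/\ U (x + s *: v + t *: w), `|A x - A (x + s *: v + t *: w)| < e / 2 &
     `|B x - B (x + s *: v + t *: w)| < e / 2].
  move=> /andP[s0 sd] /andP[t0 td]; apply: rP => /=.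
  rewrite -addrA opprD addNKr normrN.
  apply: (@le_lt_trans _ _ (d * k)); last first.
    by rewrite /d mulrAC divfK ?gt_eqF// ltr_pdivrMr// ltr_pMr// ltr1n.
  apply: (le_trans (ler_normD _ _)); rewrite !normrZ !ger0_norm//.
  rewrite /k !mulrDr mulr1 -[leLHS]addr0 lerD// ?(ltW d0)//.
  by rewrite lerD// ler_wpM2r.
have [c [c' [/andP[c0 cd] /andP[c'0 c'd] E]]] :
  exists c d', [/\ 0 < c < d, 0 < d' < d &
    h (x + d *: v + d *: w) - h (x + d *: v) - (h (x + d *: w) - h x) =
    d * (d * 'D_w (fun y => 'D_v h y) (x + c *: v + d' *: w))].
  by apply: (second_difference d0 hC) => s t sd td; have [] := box s t sd td.
have [a [a' [/andP[a0 ad] /andP[a'0 a'd] E']]] :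
  exists c d', [/\ 0 < c < d, 0 < d' < d &
    h (x + d *: w + d *: v) - h (x + d *: w) - (h (x + d *: v) - h x) =
    d * (d * 'D_v (fun y => 'D_w h y) (x + c *: w + d' *: v))].
  apply: (second_difference d0 hC) => s t sd td; rewrite addrAC.
  by have [] := box t s td sd.
have AB : A (x + c *: v + c' *: w) = B (x + a' *: v + a *: w).
  have dn : d != 0 by rewrite gt_eqF.
  apply: (mulfI dn); apply: (mulfI dn).
  rewrite -[LHS]E [x + a' *: v + _]addrAC -[RHS]E' [x + d *: w + _]addrAC.
  exact: subrBB_swap.
have cI : 0 <= c <= d by rewrite (ltW c0) (ltW cd).
have c'I : 0 <= c' <= d by rewrite (ltW c'0) (ltW c'd).
have aI : 0 <= a <= d by rewrite (ltW a0) (ltW ad).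
have a'I : 0 <= a' <= d by rewrite (ltW a'0) (ltW a'd).
have [_ h1 _] := box c c' cI c'I; have [_ _ h2] := box a' a a'I aI.
move: h1 h2; rewrite -AB; set z := A (_ + _) => h1 h2.
apply: ltW; rewrite (_ : A x - B x = (A x - z) - (B x - z)); last by rewrite opprB addrA subrK.
apply: (le_lt_trans (ler_normB _ _)); rewrite (splitr e); exact: (ltrD h1 h2).
Qed.

End Schwarz.

(** * The Euclidean inner product *)
Section DotProduct.
Variable R : realType.

Lemma dotE N (x y : 'rV[R]_N) : dot x y = (x *m y^T) 0 0.
Proof. by rewrite mxE; apply: eq_bigr => i _; rewrite mxE. Qed.

Lemma dotC N (x y : 'rV[R]_N) : dot x y = dot y x.
Proof. by apply: eq_bigr => i _; rewrite mulrC. Qed.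

Lemma dotDl N (x y z : 'rV[R]_N) : dot (x + y) z = dot x z + dot y z.
Proof. by rewrite !dotE mulmxDl mxE. Qed.

Lemma dotZl N a (x y : 'rV[R]_N) : dot (a *: x) y = a * dot x y.
Proof. by rewrite !dotE -scalemxAl mxE. Qed.

Lemma dotNl N (x y : 'rV[R]_N) : dot (- x) y = - dot x y.
Proof. by rewrite !dotE mulNmx mxE. Qed.

Lemma dotBl N (x y z : 'rV[R]_N) : dot (x - y) z = dot x z - dot y z.
Proof. by rewrite dotDl dotNl. Qed.

Lemma dotZr N a (x y : 'rV[R]_N) : dot x (a *: y) = a * dot x y.
Proof. by rewrite dotC dotZl dotC. Qed.

Lemma dot0l N (x : 'rV[R]_N) : dot 0 x = 0.
Proof. by rewrite dotE mul0mx mxE. Qed.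

Lemma dot_suml N I (s : seq I) (F : I -> 'rV[R]_N) y :
  dot (\sum_(i <- s) F i) y = \sum_(i <- s) dot (F i) y.
Proof. by rewrite dotE mulmx_suml summxE; apply: eq_bigr => i _; rewrite dotE. Qed.

Lemma dot_eq0 N (x : 'rV[R]_N) : dot x x = 0 -> x = 0.
Proof.
move=> /eqP; rewrite psumr_eq0 => [/allP x0|i _]; last by rewrite -expr2 sqr_ge0.
apply/rowP => i; rewrite mxE; apply/eqP; rewrite -(sqrf_eq0 (x 0 i)) expr2.
by have := x0 i; rewrite mem_index_enum => /(_ isT).
Qed.

Lemma dot_ge0 N (x : 'rV[R]_N) : 0 <= dot x x.
Proof. by apply: sumr_ge0 => i _; rewrite -expr2 sqr_ge0. Qed.

Lemma dot_gt0 N (x : 'rV[R]_N) : x != 0 -> 0 < dot x x.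
Proof.
by move=> x0; rewrite lt_neqAle dot_ge0 andbT eq_sym; apply: contra_neq x0; exact: dot_eq0.
Qed.

Lemma dot_row_mx n m (a c : 'rV[R]_n) (b d : 'rV[R]_m) :
  dot (row_mx a b) (row_mx c d) = dot a c + dot b d.
Proof. by rewrite !dotE tr_row_mx mul_row_col mxE. Qed.

Lemma gramE_row k l N (J : 'M[R]_(k, N)) (K : 'M[R]_(l, N)) i j :
  (J *m K^T) i j = dot (row i J) (row j K).
Proof. by rewrite mxE; apply: eq_bigr => a _; rewrite !mxE. Qed.

Lemma row_free_gram_unit k N (J : 'M[R]_(k, N)) : row_free J -> J *m J^T \in unitmx.
Proof.
move=> fJ; rewrite -row_free_unit; apply: inj_row_free => v vJ.
have : v *m J = 0.
  by apply: dot_eq0; rewrite dotE trmx_mul !mulmxA -(mulmxA v) vJ mul0mx mxE.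
by move/(canRL (mulmxKp fJ)); rewrite mul0mx.
Qed.

Lemma invmx_uniq k (A B : 'M[R]_k) : A *m B = 1%:M -> invmx A = B.
Proof.
move=> AB; have [uA _] := mulmx1_unit AB.
by rewrite -[RHS](mulKmx uA) AB mulmx1.
Qed.

Lemma derive_coord (V : normedModType R) n m (h : V -> 'M[R]_(n, m)) i j x v :
  differentiable h x -> ('D_v h x) i j = 'D_v (fun y => h y i j : R^o) x.
Proof.
move=> dh; symmetry.
apply: (@derive_lin _ _ _ _ (coordmx i j) h x v _ dh).
exact: coord_continuous.
Qed.

Lemma differentiable_coordmx (V : normedModType R) n m (h : V -> 'M[R]_(n, m)) i j x :
  differentiable h x -> differentiable (fun y => h y i j : R^o) x.
Proof.
move=> dh; apply: (@differentiable_comp _ _ _ _ h (coordmx i j)) => //.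
exact: differentiable_coord.
Qed.

Lemma derive_dot (V : normedModType R) N (h g : V -> 'rV[R]_N) x v :
  differentiable h x -> differentiable g x ->
  'D_v (fun y => dot (h y) (g y) : R^o) x = dot ('D_v h x) (g x) + dot (h x) ('D_v g x).
Proof.
move=> dh dg.
have dM (i : 'I_N) : differentiable (fun y => h y 0 i * g y 0 i : R^o) x.
  by apply: differentiableM; exact: differentiable_coordmx.
rewrite (_ : (fun y => _) = \sum_(i < N) (fun y => h y 0 i * g y 0 i : R^o)); last first.
  by apply/funext => y; rewrite fct_sumE.
rewrite derive_sum; last by move=> i; exact: diff_derivable.
rewrite -big_split; apply: eq_bigr => i _ /=.
rewrite !derive_coord//.
rewrite deriveM; [|exact/diff_derivable/differentiable_coordmx..].
by rewrite addrC; congr (_ + _); rewrite [LHS]mulrC.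
Qed.

End DotProduct.

(** * The trace Laplacian of an immersion *)
Section MetricLaplacian.
Variable R : realType.

Lemma trace_metricD k (W : lmodType R) (g : 'M[R]_k) (B B' : 'I_k -> 'I_k -> W) :
  trace_metric g (fun i j => B i j + B' i j) = trace_metric g B + trace_metric g B'.
Proof.
rewrite -big_split; apply: eq_bigr => i _; rewrite -big_split; apply: eq_bigr => j _.
by rewrite scalerDr.
Qed.

Lemma trace_metric_lin k (W W' : lmodType R) (l : {linear W -> W'}) (g : 'M[R]_k)
    (B : 'I_k -> 'I_k -> W) :
  l (trace_metric g B) = trace_metric g (fun i j => l (B i j)).
Proof.
rewrite linear_sum; apply: eq_bigr => i _; rewrite linear_sum; apply: eq_bigr => j _.
by rewrite linearZ.
Qed.

Lemma trace_metric_mulmx k p q (M : 'M[R]_(p, q)) (g : 'M[R]_k)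
    (B : 'I_k -> 'I_k -> 'rV[R]_p) :
  trace_metric g (fun i j => B i j *m M) = trace_metric g B *m M.
Proof. exact/esym/(trace_metric_lin (mulmxr M)). Qed.

Lemma trace_metricN k (W : lmodType R) (g : 'M[R]_k) (B : 'I_k -> 'I_k -> W) :
  trace_metric g (fun i j => - B i j) = - trace_metric g B.
Proof. by rewrite (trace_metric_lin (-%R : {linear W -> W})). Qed.

Lemma eq_trace_metric k (W : lmodType R) (g : 'M[R]_k) (B B' : 'I_k -> 'I_k -> W) :
  (forall i j, B i j = B' i j) -> trace_metric g B = trace_metric g B'.
Proof. by move=> BB'; apply: eq_bigr => i _; apply: eq_bigr => j _; rewrite BB'. Qed.

Lemma trace_metric_row_mx k a b (h : 'M[R]_k) (B : 'I_k -> 'I_k -> 'rV[R]_a)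
    (B' : 'I_k -> 'I_k -> 'rV[R]_b) :
  trace_metric h (fun i j => row_mx (B i j) (B' i j))
  = row_mx (trace_metric h B) (trace_metric h B').
Proof.
rewrite -[LHS]hsubmxK (trace_metric_lin lsubmx) (trace_metric_lin rsubmx).
congr row_mx; apply: eq_trace_metric => i j; [exact: row_mxKl|exact: row_mxKr].
Qed.

Lemma trace_metricZ k (W : lmodType R) (h : 'M[R]_k) (a : R) (B : 'I_k -> 'I_k -> W) :
  trace_metric h (fun i j => a *: B i j) = a *: trace_metric h B.
Proof. exact/esym/(trace_metric_lin ( *:%R a)). Qed.

Lemma trace_metric_comb k p (W : lmodType R) (g : 'M[R]_k) (a : 'I_k -> 'I_k -> 'rV[R]_p)
    (w : 'I_p -> W) :
  trace_metric g (fun i j => \sum_l a i j 0 l *: w l) =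
  \sum_l (trace_metric g a) 0 l *: w l.
Proof.
rewrite /trace_metric.
under eq_bigr do under eq_bigr do rewrite scaler_sumr.
under eq_bigr do rewrite exchange_big.
rewrite exchange_big; apply: eq_bigr => l _.
rewrite summxE scaler_suml; apply: eq_bigr => i _.
rewrite summxE scaler_suml; apply: eq_bigr => j _.
by rewrite mxE scalerA.
Qed.

(** The trace of a bilinear form does not depend on the basis: A is the matrix
    of the change of basis. *)
Lemma trace_metric_congr k (W : lmodType R) (A g : 'M[R]_k) (B : 'I_k -> 'I_k -> W) :
  A \in unitmx -> g \in unitmx ->
  trace_metric (A *m g *m A^T)
    (fun i j => \sum_b \sum_a (A i b * A j a) *: B b a) = trace_metric g B.
Proof.
move=> uA ug.
have e : A^T *m invmx (A *m g *m A^T) *m A = invmx g.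
  rewrite (@invmx_uniq _ _ _ (invmx A^T *m invmx g *m invmx A)).
    by rewrite !mulmxA mulmxV ?unitmx_tr// mul1mx mulmxKV.
  by rewrite !mulmxA mulmxK ?unitmx_tr// mulmxK// mulmxV.
rewrite /trace_metric -e.
transitivity (\sum_i \sum_j \sum_b \sum_a
  (invmx (A *m g *m A^T) i j * (A i b * A j a)) *: B b a).
  apply: eq_bigr => i _; apply: eq_bigr => j _; rewrite scaler_sumr.
  by apply: eq_bigr => b _; rewrite scaler_sumr; apply: eq_bigr => a _; rewrite scalerA.
transitivity (\sum_b \sum_a \sum_i \sum_j
  (invmx (A *m g *m A^T) i j * (A i b * A j a)) *: B b a).
  under eq_bigr do rewrite exchange_big.
  rewrite exchange_big; apply: eq_bigr => b _.
  under eq_bigr do rewrite exchange_big.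
  by rewrite exchange_big.
apply: eq_bigr => b _; apply: eq_bigr => a _.
under eq_bigr do rewrite -scaler_suml.
rewrite -scaler_suml; congr (_ *: _).
rewrite mxE; under [RHS]eq_bigr do rewrite mxE mulr_suml.
rewrite [RHS]exchange_big; apply: eq_bigr => i _; apply: eq_bigr => j _.
by rewrite mxE mulrCA mulrA.
Qed.

(** The coordinates, in the basis of the partial derivatives of Psi, of the
    tangential part of the trace of its second derivatives.  By
    [christoffel_gram] the l-th one is the trace of the symbols Gamma^l_ij. *)
Definition drift k N (Psi : 'rV[R]_k -> 'rV[R]_N) (u : 'rV[R]_k) : 'rV[R]_k :=
  trace_metric (gram Psi u) (fun i j => partial i (partial j Psi) u)
    *m ('J Psi u)^T *m invmx (gram Psi u).

(** For Psi it is the mean curvature vector, for a function the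
    Laplace-Beltrami operator; values in any normed space are allowed so that
    one invariance statement covers both. *)
Definition lap k N (V : normedModType R) (Psi : 'rV[R]_k -> 'rV[R]_N)
    (W : 'rV[R]_k -> V) (u : 'rV[R]_k) : V :=
  trace_metric (gram Psi u) (fun i j => partial i (partial j W) u)
  - \sum_l drift Psi u 0 l *: partial l W u.

Lemma mulmx_jacobian k N (Psi : 'rV[R]_k -> 'rV[R]_N) u (c : 'rV[R]_k) :
  differentiable Psi u -> c *m 'J Psi u = \sum_l c 0 l *: partial l Psi u.
Proof. by move=> dP; rewrite mulmx_sum_row; apply: eq_bigr => l _; rewrite jacobian_row. Qed.

Lemma mean_curvatureE k N (Psi : 'rV[R]_k -> 'rV[R]_N) u :
  differentiable Psi u -> mean_curvature Psi u = lap Psi Psi u.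
Proof.
move=> dP; rewrite /mean_curvature /normal_proj /lap trace_metricD trace_metricN.
by congr (_ - _); rewrite -mulmx_jacobian// !trace_metric_mulmx.
Qed.

Lemma partialC k N (Psi : 'rV[R]_k -> 'rV[R]_N) U u i j :
  open_nbhs u U -> Ck 2 U Psi -> partial i (partial j Psi) u = partial j (partial i Psi) u.
Proof.
move=> [oU Uu] C2; have [dP DP] := C2; apply/rowP => a.
have dD v : differentiable (fun y => 'D_v Psi y) u by have [+ _] := DP v; apply.
have e v w : ('D_w (fun y => 'D_v Psi y) u) 0 a =
    'D_w (fun y => 'D_v (fun z => Psi z 0 a : R^o) y) u.
  apply: (etrans (derive_coord 0 a w (dD v))).
  apply: near_eq_derive; apply: filterS (open_nbhs_nbhs (conj oU Uu)) => y Uy.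
  exact: (derive_coord 0 a v (dP y Uy)).
apply: (etrans (e _ _)); apply: (etrans _ (esym (e _ _))).
apply: (@derive_comm R _ (fun z => Psi z 0 a : R^o) U) => //.
exact: Ck_coord.
Qed.

Lemma gram_sym k N (Psi : 'rV[R]_k -> 'rV[R]_N) u : (gram Psi u)^T = gram Psi u.
Proof. by rewrite /gram trmx_mul trmxK. Qed.

Lemma partial_gram k N (Psi : 'rV[R]_k -> 'rV[R]_N) U u i j s :
  open_nbhs u U -> Ck 2 U Psi ->
  partial i (fun v => gram Psi v j s) u =
    dot (partial i (partial j Psi) u) (partial s Psi u)
    + dot (partial j Psi u) (partial i (partial s Psi) u).
Proof.
move=> [oU Uu] [dP DP].
have dD v : differentiable (fun y => 'D_v Psi y) u by have [+ _] := DP v; apply.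
rewrite {1}/partial -derive_dot; [|exact: dD|exact: dD].
apply: near_eq_derive; apply: filterS (open_nbhs_nbhs (conj oU Uu)) => y Uy.
by rewrite gramE_row !jacobian_row//; exact: dP.
Qed.

(** The alternating sum of first derivatives of the metric keeps a single
    product because second derivatives commute. *)
Lemma koszul k N (D1 : 'I_k -> 'rV[R]_N) (D2 : 'I_k -> 'I_k -> 'rV[R]_N) :
  (forall a b, D2 a b = D2 b a) -> forall i j s,
  dot (D2 i j) (D1 s) + dot (D1 j) (D2 i s) + (dot (D2 j i) (D1 s) + dot (D1 i) (D2 j s))
  - (dot (D2 s i) (D1 j) + dot (D1 i) (D2 s j)) = dot (D2 i j) (D1 s) *+ 2.
Proof.
move=> C i j s; rewrite (C s i) (C s j) (C j i) (dotC (D1 j)).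
by rewrite mulr2n addrACA addrK.
Qed.


(** Formula of Gauss: the Levi-Civita connection of the induced metric is the
    tangential part of the flat derivative. *)
Lemma christoffel_gram k N (Psi : 'rV[R]_k -> 'rV[R]_N) U u l i j :
  open_nbhs u U -> Ck 2 U Psi ->
  christoffel (gram Psi) l i j u =
    (partial i (partial j Psi) u *m ('J Psi u)^T *m invmx (gram Psi u)) 0 l.
Proof.
move=> Uu C2; have [dP DP] := C2; have Du := dP _ Uu.2.
have C a b := partialC a b Uu C2.
have P a b c := partial_gram a b c Uu C2.
have E s : partial i (fun v => gram Psi v j s) u + partial j (fun v => gram Psi v i s) u
    - partial s (fun v => gram Psi v i j) u
    = dot (partial i (partial j Psi) u) (partial s Psi u) *+ 2.
  apply: (etrans (congr2 +%R (congr2 +%R (P i j s) (P j i s)) (congr1 -%R (P s i j)))).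
  exact: (koszul (fun a => partial a Psi u) C i j s).
have sym s : invmx (gram Psi u) l s = invmx (gram Psi u) s l.
  have : (invmx (gram Psi u))^T = invmx (gram Psi u) by rewrite trmx_inv gram_sym.
  by move/matrixP => /(_ s l); rewrite mxE.
rewrite /christoffel (eq_bigr _ (fun s _ => congr2 *%R (sym s) (E s))) mulr_sumr [RHS]mxE.
apply: eq_bigr => s _; rewrite gramE_row row_id jacobian_row//.
by rewrite mulrCA -[dot _ _ *+ 2]mulr_natl mulKf// mulrC.
Qed.

Lemma lapE k N (V : normedModType R) (Psi : 'rV[R]_k -> 'rV[R]_N) U u (W : 'rV[R]_k -> V)
    (B : 'I_k -> 'I_k -> V) :
  open_nbhs u U -> Ck 2 U Psi ->
  trace_metric (gram Psi u) (fun i j => B i j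
     - \sum_l christoffel (gram Psi) l i j u *: partial l W u) =
  trace_metric (gram Psi u) B - \sum_l drift Psi u 0 l *: partial l W u.
Proof.
move=> Uu C2; rewrite trace_metricD trace_metricN; congr (_ - _).
under eq_trace_metric => i j do under eq_bigr => l _ do rewrite (christoffel_gram l i j Uu C2).
rewrite trace_metric_comb; apply: eq_bigr => l _; congr (_ 0 l *: _).
by rewrite !trace_metric_mulmx.
Qed.

Lemma laplace_beltramiE k N (Psi : 'rV[R]_k -> 'rV[R]_N) U u (h : 'rV[R]_k -> R^o) :
  open_nbhs u U -> Ck 2 U Psi -> laplace_beltrami (gram Psi) h u = lap Psi h u.
Proof. by move=> Uu C2; rewrite /laplace_beltrami (lapE _ _ Uu C2). Qed.

Lemma sphere_tangentE m (y v : 'rV[R]_m.+1) :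
  sphere_tangent y v = v *m (1%:M - y^T *m y).
Proof.
rewrite /sphere_tangent mulmxBr mulmx1 mulmxA; congr (_ - _).
by rewrite [v *m y^T]mx11_scalar mul_scalar_mx dotE.
Qed.

(** The Christoffel term is already tangent to the sphere, since the partial
    derivatives of w are. *)
Lemma tensionE k N m (Psi : 'rV[R]_k -> 'rV[R]_N) U u (w : 'rV[R]_k -> 'rV[R]_m.+1) :
  open_nbhs u U -> Ck 2 U Psi ->
  (forall l, dot (partial l w u) (w u) = 0) ->
  tension (gram Psi) w u = sphere_tangent (w u) (lap Psi w u).
Proof.
move=> Uu C2 wt; rewrite /tension (lapE _ _ Uu C2).
under eq_trace_metric => i j do rewrite sphere_tangentE.
rewrite trace_metric_mulmx -sphere_tangentE /sphere_tangent /lap dotBl.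
have -> : dot (\sum_l drift Psi u 0 l *: partial l w u) (w u) = 0.
  by rewrite dot_suml big1// => l _; rewrite dotZl wt mulr0.
by rewrite subr0 addrAC.
Qed.


Lemma partial_comp k p (V : normedModType R) (phi : 'rV[R]_k -> 'rV[R]_p)
    (W : 'rV[R]_p -> V) u i :
  differentiable phi u -> differentiable W (phi u) ->
  partial i (W \o phi) u = \sum_a 'J phi u i a *: partial a W (phi u).
Proof.
move=> dphi dW; rewrite /partial derive_comp// [in LHS]deriveEjacobian// -rowE.
rewrite [in LHS](row_sum_delta (row i _)) deriveE// linear_sum.
by apply: eq_bigr => a _; rewrite linearZ/= mxE deriveE.
Qed.

(** The second sum, which involves second derivatives of phi, is what prevents
    the Hessian from being a tensor; in [lap_comp] it cancels against the same
    term in the drift. *)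
Lemma partial2_comp k p (V : normedModType R) (phi : 'rV[R]_k -> 'rV[R]_p)
    (W : 'rV[R]_p -> V) (U : set 'rV[R]_k) (U' : set 'rV[R]_p) u i j :
  open_nbhs u U -> (forall v, U v -> U' (phi v)) -> Ck 2 U phi -> Ck 2 U' W ->
  partial i (partial j (W \o phi)) u =
    \sum_b \sum_a ('J phi u i b * 'J phi u j a) *: partial b (partial a W) (phi u)
    + \sum_a (partial i (partial j phi) u) 0 a *: partial a W (phi u).
Proof.
move=> [oU Uu] UU' [dphi Dphi] [dW DW].
have dphi2 : differentiable (partial j phi) u by have [+ _] := Dphi (delta_mx 0 j); apply.
have dW2 a : differentiable (partial a W) (phi u).
  by have [+ _] := DW (delta_mx 0 a); apply; exact: UU'.
have dT a : differentiable (fun v => (partial j phi v) 0 a *: partial a W (phi v)) u.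
  apply: differentiable_scale; first exact: differentiable_coordmx.
  by apply: (@differentiable_comp _ _ _ _ phi (partial a W)) => //; exact: dphi.
transitivity (partial i (\sum_a (fun v => (partial j phi v) 0 a *: partial a W (phi v))) u).
  apply: near_eq_derive; apply: filterS (open_nbhs_nbhs (conj oU Uu)) => v Uv.
  rewrite partial_comp; [|exact: dphi|exact/dW/UU'].
  rewrite fct_sumE; apply: eq_bigr => a _; congr (_ *: _).
  by rewrite -jacobian_row ?mxE//; exact: dphi.
rewrite /partial derive_sum; last by move=> a; exact: diff_derivable.
rewrite exchange_big -big_split; apply: eq_bigr => a _ /=.
rewrite derive_scale//; last 2 first.
- exact: differentiable_coordmx.
- by apply: (@differentiable_comp _ _ _ _ phi (partial a W)) => //; exact: dphi.
rewrite addrC; congr (_ + _); 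
  first by congr (_ *: _); apply: esym; exact: derive_coord dphi2.
have -> : ('D_(delta_mx 0 j) phi u) 0 a = 'J phi u j a.
  by rewrite -[LHS]/(partial j phi u 0 a) -jacobian_row ?mxE//; exact: dphi.
have := @partial_comp _ _ _ phi (partial a W) u i (dphi u Uu) (dW2 a).
rewrite /partial => ->; rewrite scaler_sumr; apply: eq_bigr => b _.
by rewrite scalerA mulrC.
Qed.

Lemma jacobian_comp k p N (phi : 'rV[R]_k -> 'rV[R]_p) (Gam : 'rV[R]_p -> 'rV[R]_N) u :
  differentiable phi u -> differentiable Gam (phi u) ->
  'J (Gam \o phi) u = 'J phi u *m 'J Gam (phi u).
Proof.
move=> dphi dG; apply/row_matrixP => i.
rewrite jacobian_row; last exact: differentiable_comp.
by rewrite row_mul /partial derive_comp// deriveEjacobian// jacobian_row.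
Qed.

(** With z the trace of the second derivatives of phi, the trace of the second
    derivatives of W and the drift of Gam are both shifted by z. *)
Lemma lap_comp k N (V : normedModType R) (phi : 'rV[R]_k -> 'rV[R]_k)
    (Gam : 'rV[R]_k -> 'rV[R]_N) (W : 'rV[R]_k -> V) (U U' : set 'rV[R]_k) u :
  open_nbhs u U -> (forall v, U v -> U' (phi v)) -> Ck 2 U phi -> Ck 2 U' Gam -> Ck 2 U' W ->
  'J phi u \in unitmx -> gram Gam (phi u) \in unitmx ->
  lap (Gam \o phi) (W \o phi) u = lap Gam W (phi u).
Proof.
move=> Uu UU' Cphi CG CW uJ ug.
have dphi : differentiable phi u by case: Cphi => + _; apply; exact: Uu.2.
have U'u := UU' u Uu.2.
have dG : differentiable Gam (phi u) by case: CG => + _; exact.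
have dW : differentiable W (phi u) by case: CW => + _; exact.
have JE := jacobian_comp dphi dG.
have gE : gram (Gam \o phi) u = 'J phi u *m gram Gam (phi u) *m ('J phi u)^T.
  by rewrite /gram JE trmx_mul !mulmxA.
pose z := trace_metric (gram (Gam \o phi) u) (fun i j => partial i (partial j phi) u).
have traceE (V' : normedModType R) (X : 'rV[R]_k -> V') : Ck 2 U' X ->
    trace_metric (gram (Gam \o phi) u) (fun i j => partial i (partial j (X \o phi)) u) =
    trace_metric (gram Gam (phi u)) (fun i j => partial i (partial j X) (phi u))
    + \sum_a z 0 a *: partial a X (phi u).
  move=> CX.
  apply: (etrans (eq_trace_metric _ (fun i j => partial2_comp i j Uu UU' Cphi CX))).
  apply: (etrans (trace_metricD _ _ _)); congr (_ + _).
    by rewrite gE; exact: trace_metric_congr.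
  exact: trace_metric_comb.
have dE : drift (Gam \o phi) u = (drift Gam (phi u) + z) *m invmx ('J phi u).
  apply: (etrans (congr1 (fun y => y *m _ *m _) (traceE _ _ CG))).
  rewrite -mulmx_jacobian// JE trmx_mul.
  rewrite (@invmx_uniq _ _ (gram _ u) (invmx ('J phi u)^T *m invmx (gram Gam (phi u)) *m
     invmx ('J phi u))); last first.
    rewrite gE; move: (gram Gam (phi u)) ug ('J phi u) uJ => G uG A uA.
    by rewrite !mulmxA mulmxK ?unitmx_tr// mulmxK// mulmxV.
  rewrite !mulmxA mulmxK ?unitmx_tr// !mulmxDl; congr (_ *m _ + _ *m _).
  by rewrite -(mulmxA z) mulmxK.
have sE : \sum_l drift (Gam \o phi) u 0 l *: partial l (W \o phi) u =
    \sum_a (drift Gam (phi u) + z) 0 a *: partial a W (phi u).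
  under eq_bigr => l _ do rewrite partial_comp// scaler_sumr.
  rewrite exchange_big; apply: eq_bigr => a _.
  under eq_bigr do rewrite scalerA.
  rewrite -scaler_suml; congr (_ *: _).
  have := congr1 (fun M => (M *m 'J phi u) 0 a) dE.
  by rewrite mulmxKV// mxE.
apply: (etrans (congr2 (fun x y => x - y) (traceE _ _ CW) sE)).
under [X in _ - X]eq_bigr do rewrite mxE scalerDl.
by rewrite big_split opprD addrA addrAC addrK.
Qed.

End MetricLaplacian.

(** * Traces, characteristic polynomials and orthonormal bases *)
Section LinearAlgebra.
Variable R : realType.

Lemma poly_eq_nonzero (p q : {poly R}) :
  (forall x, x != 0 -> p.[x] = q.[x]) -> p = q.
Proof.
move=> pq; apply/eqP; rewrite -subr_eq0; apply/negPn/negP => d0.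
pose rs := [seq (i.+1%:R : R) | i <- iota 0 (size (p - q))].
suff : (size rs < size (p - q)%R)%N by rewrite size_map size_iota ltnn.
apply: max_poly_roots => //.
- apply/allP => _ /mapP[i _ ->].
  by rewrite rootE hornerD hornerN (pq i.+1%:R) ?subrr ?pnatr_eq0.
- rewrite map_inj_uniq ?iota_uniq// => i j /eqP.
  by rewrite eqr_nat => /eqP[].
Qed.

Lemma horner_char_poly k (A : 'M[R]_k) x : (char_poly A).[x] = \det (x%:M - A).
Proof.
rewrite /char_poly -[LHS]/(horner_eval x _) -det_map_mx; congr (\det _).
apply/matrixP => i j; rewrite !mxE rmorphB rmorphMn /=.
by rewrite /horner_eval hornerX hornerC.
Qed.

Lemma trace_prod_XsubC k (A : 'M[R]_k) (mu : 'I_k -> R) :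
  char_poly A = \prod_i ('X - (mu i)%:P) -> \tr A = \sum_i mu i.
Proof.
case: k A mu => [|k] A mu; first by rewrite /mxtrace !big_ord0.
move=> cA; apply: oppr_inj; rewrite -char_poly_trace// cA.
have := @coefPn_prod_XsubC R [seq mu i | i <- index_enum 'I_k.+1].
rewrite size_map.
have -> : size (index_enum 'I_k.+1) = k.+1 by rewrite -[RHS]card_ord cardT enumT.
by rewrite !big_map => ->.
Qed.

Lemma det_affine k (M : 'M[R]_k) (mu : 'I_k -> R) :
  char_poly M = \prod_i ('X - (mu i)%:P) ->
  forall a b, b != 0 -> \det (a%:M + b *: M) = \prod_i (a + b * mu i).
Proof.
move=> cM a b b0.
have -> : a%:M + b *: M = - b *: ((- (a / b))%:M - M).
  by rewrite scalerBr scale_scalar_mx mulrNN mulrC divfK// scaleNr opprK.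
rewrite detZ -horner_char_poly cM horner_prod.
have -> : (- b) ^+ k = \prod_(i < k) - b by rewrite prodr_const card_ord.
rewrite -big_split; apply: eq_bigr => i _ /=.
by rewrite hornerXsubC mulrBr mulrNN mulNr opprK mulrCA divff// mulr1.
Qed.

(** The characteristic polynomial of the inverse of A = a + b M is determined by
    that of M, because x - A^-1 is A^-1 (x A - 1) and x A - 1 is again affine in
    M.  This identity needs x != 0, whence [poly_eq_nonzero]. *)
Lemma trace_inv_affine k (M : 'M[R]_k) (mu : 'I_k -> R) a b : b != 0 ->
  char_poly M = \prod_i ('X - (mu i)%:P) -> (forall i, a + b * mu i != 0) ->
  \tr (invmx (a%:M + b *: M)) = \sum_i (a + b * mu i)^-1.
Proof.
move=> b0 cM nz; set A := a%:M + b *: M.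
have dA : \det A = \prod_i (a + b * mu i) by exact: det_affine.
have uA : A \in unitmx.
  by rewrite unitmxE dA unitfE; apply/prodf_neq0 => i _.
apply: trace_prod_XsubC; apply: poly_eq_nonzero => x x0.
rewrite horner_char_poly horner_prod.
have -> : x%:M - invmx A = invmx A *m ((x * a - 1)%:M + (x * b) *: M).
  have -> : (x * a - 1)%:M + (x * b) *: M = x *: A - 1%:M.
    by rewrite /A scalerDr scale_scalar_mx scalerA raddfB /= addrAC.
  by rewrite mulmxBr mulmx1 -scalemxAr mulVmx// scalemx1.
rewrite det_mulmx det_inv dA (det_affine cM) ?mulf_neq0// -prodfV -big_split.
apply: eq_bigr => i _ /=; rewrite hornerXsubC.
by apply: (mulfI (nz i)); rewrite mulVKf// mulrBr mulfV//; ring.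
Qed.

Definition posdef k (g : 'M[R]_k) := forall v : 'rV[R]_k, v != 0 -> 0 < (v *m g *m v^T) 0 0.

Lemma posdef_gram k N (J : 'M[R]_(k, N)) : row_free J -> posdef (J *m J^T).
Proof.
move=> fJ v v0; rewrite mulmxA -mulmxA -trmx_mul -dotE; apply: dot_gt0.
by rewrite mulmx_free_eq0.
Qed.

(** Gram-Schmidt in matrix form: one step of elimination leaves the Schur
    complement D', which is positive definite, as w of the proof shows. *)
Lemma posdef_orthonormal k (g : 'M[R]_k) : g^T = g -> posdef g ->
  exists E : 'M[R]_k, E *m g *m E^T = 1%:M.
Proof.
elim: k g => [|k IH] g gs gp; first by exists 1%:M; apply/matrixP => -[].
pose a := g 0 0; pose b : 'rV[R]_k := ursubmx (g : 'M[R]_(1 + k)).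
pose D : 'M[R]_k := drsubmx (g : 'M[R]_(1 + k)).
have gE : (g : 'M[R]_(1 + k)) = block_mx a%:M b (b^T) D.
  rewrite -[LHS](@submxK _ 1 k 1 k); congr block_mx.
    by rewrite [LHS]mx11_scalar !mxE; congr (g _ _)%:M; apply: val_inj.
  by rewrite /b trmx_ursub gs.
have a0 : 0 < a.
  have := gp (delta_mx 0 0); rewrite trmx_delta -rowE -colE !mxE; apply.
  by apply/eqP => /matrixP/(_ 0 0); rewrite !mxE !eqxx => /eqP; rewrite oner_eq0.
have gp' : posdef (block_mx a%:M b (b^T) D) by rewrite -gE.
have DT : D^T = D by rewrite /D trmx_drsub gs.
pose D' := D - a^-1 *: (b^T *m b).
have [||E' HE'] := IH D'.
- by rewrite /D' linearB linearZ /= trmx_mul trmxK DT.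
- move=> v v0.
  (* The first coordinate makes w orthogonal, for g, to the first basis vector. *)
  pose w : 'rV[R]_(1 + k) := row_mx (- a^-1 *: (v *m b^T)) v.
  have w0 : w != 0.
    by apply: contra_neq v0 => /(congr1 rsubmx); rewrite row_mxKr => ->; rewrite linear0.
  have := gp' w w0; rewrite /w tr_row_mx mul_row_block mul_row_col.
  set s := v *m b^T; rewrite mul_mx_scalar scalerA mulrN mulfV ?gt_eqF//.
  rewrite scaleN1r addNr mul0mx add0r.
  by rewrite -scalemxAl scaleNr addrC /D' mulmxBr -scalemxAr mulmxA.
pose s := (Num.sqrt a)^-1.
pose E : 'M[R]_(1 + k) := block_mx s%:M 0 (- a^-1 *: (E' *m b^T)) E'.
suff EH : E *m block_mx a%:M b (b^T) D *m E^T = 1%:M by exists E; rewrite -gE in EH.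
rewrite /E.
have s2 : s * a * s = 1.
  rewrite /s mulrAC -invfM -expr2 sqr_sqrtr ?ltW// mulVf// gt_eqF//.
rewrite tr_block_mx trmx0.
rewrite mulmx_block !mul0mx !addr0 mulmx_block !mulmx0 !addr0.
rewrite tr_scalar_mx -!scalar_mxM s2 !mul_mx_scalar !scalerA mulrN mulfV ?gt_eqF//.
rewrite scaleN1r addNr scaler0 mul0mx !add0r.
rewrite [X in block_mx _ X _ _](_ : _ = 0); last first.
  rewrite !mul_scalar_mx linearZ /= trmx_mul trmxK.
  by rewrite scalerA mulrN mulfK ?gt_eqF// scaleNr -scalemxAl addNr.
rewrite [X in block_mx _ _ _ X](_ : _ = 1%:M) ?scalar_mx_block// -HE' /D'.
by rewrite mulmxBr -!scalemxAr -!scalemxAl scaleNr addrC -!mulmxA.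
Qed.

Lemma invmx_orthonormal k (g E : 'M[R]_k) : E *m g *m E^T = 1%:M -> invmx g = E^T *m E.
Proof. by move=> Eg; apply: invmx_uniq; rewrite mulmxA; apply: mulmx1C; rewrite mulmxA. Qed.

Lemma mxtrace_congr k (P g X : 'M[R]_k) : P \in unitmx -> g \in unitmx ->
  \tr (invmx (P *m g *m P^T) *m (P *m X *m P^T)) = \tr (invmx g *m X).
Proof.
move=> uP ug.
rewrite (@invmx_uniq _ _ _ (invmx P^T *m invmx g *m invmx P)); last first.
  by rewrite !mulmxA mulmxK ?unitmx_tr// mulmxK// mulmxV.
by rewrite !mulmxA mulmxKV// mxtrace_mulC !mulmxA mulmxV ?unitmx_tr// mul1mx.
Qed.

Lemma trace_metric_mx k (g M : 'M[R]_k) :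
  trace_metric g (fun i j => M i j : R^o) = \tr (invmx g *m M^T).
Proof. by apply: eq_bigr => i _; rewrite mxE; apply: eq_bigr => j _; rewrite mxE. Qed.

End LinearAlgebra.

(** * Coordinates on a half-line times a chart *)
Section ProductCoordinates.
Variable R : realType.
Implicit Types V W : normedModType R.

Lemma derive_row_mx V p q (a : V -> 'rV[R]_p) (b : V -> 'rV[R]_q) x v :
  differentiable a x -> differentiable b x ->
  differentiable (fun y => row_mx (a y) (b y)) x ->
  'D_v (fun y => row_mx (a y) (b y)) x = row_mx ('D_v a x) ('D_v b x).
Proof.
move=> da db dab; apply/rowP => j.
apply: (etrans (derive_coord 0 j v dab)).
case: (split_ordP j) => l ->.
- rewrite row_mxEl; apply: (etrans _ (esym (derive_coord 0 l v da))).
  by congr ('D_v _ x); apply/funext => y; rewrite row_mxEl.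
- rewrite row_mxEr; apply: (etrans _ (esym (derive_coord 0 l v db))).
  by congr ('D_v _ x); apply/funext => y; rewrite row_mxEr.
Qed.

Lemma derive1_scale (W : normedModType R) (a : R -> R) (y : W) (t : R) :
  differentiable (a : R -> R^o) t ->
  (fun s => a s *: y)^`()%classic t = a^`()%classic t *: y.
Proof.
move=> da; rewrite !derive1E.
have := @derive_scale R R^o W a (cst y) t 1 da (differentiable_cst y t).
by rewrite derive_cst scaler0 addr0.
Qed.

Lemma derive1_row_mx p q (a : R -> 'rV[R]_p) (b : R -> 'rV[R]_q) (t : R) :
  differentiable a t -> differentiable b t ->
  differentiable (fun s => row_mx (a s) (b s)) t ->
  (fun s => row_mx (a s) (b s))^`()%classic t = row_mx (a^`()%classic t) (b^`()%classic t).
Proof. by move=> *; rewrite !derive1E derive_row_mx. Qed.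

(** The dimension is written 1 + n, convertible to n.+1, so that the radial
    coordinate and the coordinates of the chart are the two blocks. *)
Definition cyl n (t : R) (u : 'rV[R]_n) : 'rV[R]_(1 + n) := row_mx t%:M u.

Lemma cyl_addr n s t (u : 'rV[R]_n) i :
  s *: delta_mx 0 (rshift 1 i) + cyl t u = cyl t (s *: delta_mx 0 i + u).
Proof.
apply/rowP => j; rewrite mxE; case: (split_ordP j) => l ->.
  by rewrite !row_mxEl !mxE eq_lrshift andbF mulr0 add0r.
by rewrite !row_mxEr !mxE eq_rshift.
Qed.

Lemma cyl_addl n s t (u : 'rV[R]_n) :
  s *: delta_mx 0 (lshift n 0) + cyl t u = cyl (s + t) u.
Proof.
apply/rowP => j; rewrite mxE; case: (split_ordP j) => l ->.
  by rewrite !row_mxEl !mxE eq_lshift !ord1 eqxx mulr1.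
by rewrite !row_mxEr !mxE eq_rlshift andbF mulr0 add0r.
Qed.

Lemma partial_rshift n W (h : 'rV[R]_(1 + n) -> W) t u i :
  partial (rshift 1 i) h (cyl t u) = partial i (fun v => h (cyl t v)) u.
Proof. by rewrite /partial /derive; under eq_fun do rewrite /= cyl_addr. Qed.

Lemma partial_lshift n W (h : 'rV[R]_(1 + n) -> W) t u :
  partial (lshift n 0) h (cyl t u) = (fun s => h (cyl s u))^`()%classic t.
Proof. by rewrite /partial /derive /derive1; under eq_fun do rewrite /= cyl_addl. Qed.

Lemma partial2_rshift n W (h : 'rV[R]_(1 + n) -> W) t u i j :
  partial (rshift 1 i) (partial (rshift 1 j) h) (cyl t u) =
  partial i (partial j (fun v => h (cyl t v))) u.
Proof.
apply: (etrans (partial_rshift _ _ _ _)).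
have E : (fun v => partial (rshift 1 j) h (cyl t v)) = partial j (fun v => h (cyl t v)).
  by apply/funext => v; exact: partial_rshift.
exact: (congr1 (fun k => partial i k u) E).
Qed.

Lemma partial2_lshift n W (h : 'rV[R]_(1 + n) -> W) t u :
  partial (lshift n 0) (partial (lshift n 0) h) (cyl t u) =
  (fun s => (fun s' => h (cyl s' u))^`()%classic s)^`()%classic t.
Proof.
apply: (etrans (partial_lshift _ _ _)).
have E : (fun s => partial (lshift n 0) h (cyl s u)) =
    (fun s => (fun s' => h (cyl s' u))^`()%classic s).
  by apply/funext => s; exact: partial_lshift.
exact: (congr1 (fun k : R -> W => k^`()%classic t) E).
Qed.

Lemma invmx_block_scalar n (q : R) (g : 'M[R]_n) : q != 0 -> g \in unitmx ->
  invmx (block_mx q%:M 0 0 g : 'M[R]_(1 + n)) = block_mx q^-1%:M 0 0 (invmx g).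
Proof.
move=> q0 ug; apply: invmx_uniq.
rewrite (@mulmx_block _ 1 n 1 n 1 n) !mul0mx !mulmx0 !addr0 !add0r mulmxV//.
by rewrite -scalar_mxM mulfV// -scalar_mx_block.
Qed.

Lemma trace_metric_block n (W' : lmodType R) (q : R) (g : 'M[R]_n)
    (B : 'I_(1 + n) -> 'I_(1 + n) -> W') : q != 0 -> g \in unitmx ->
  trace_metric (block_mx q%:M 0 0 g) B =
  q^-1 *: B (lshift n 0) (lshift n 0)
  + trace_metric g (fun i j => B (rshift 1 i) (rshift 1 j)).
Proof.
move=> q0 ug; rewrite /trace_metric invmx_block_scalar//.
rewrite big_split_ord big_ord1 big_split_ord big_ord1 /=; congr (_ + _).
  rewrite block_mxEul mxE eqxx mulr1n big1 ?addr0// => j _.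
  by rewrite block_mxEur mxE scale0r.
apply: eq_bigr => i _; rewrite big_split_ord big_ord1 /=.
rewrite block_mxEdl mxE scale0r add0r; apply: eq_bigr => j _.
by rewrite block_mxEdr.
Qed.

(** A unit vector and a basis of its orthogonal complement form a basis. *)
Lemma sphere_frame_unit n (x : 'rV[R]_n.+1) (J : 'M[R]_(n, n.+1)) :
  dot x x = 1 -> J *m x^T = 0 -> row_free J -> (col_mx x J : 'M[R]_n.+1) \in unitmx.
Proof.
move=> xx Jx fJ; rewrite -row_free_unit; apply: inj_row_free => v.
have [a [b ->]] : exists (a : 'rV[R]_1) (b : 'rV[R]_n), v = row_mx a b.
  by exists (@lsubmx R 1 1 n v), (@rsubmx R 1 1 n v); exact/esym/(@hsubmxK R 1 1 n).
move=> E; have {}E := etrans (esym (@mul_row_col R 1 1 n n.+1 a b x J)) E.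
have a0 : a = 0.
  have := congr1 (mulmxr x^T) E; rewrite /= mulmxDl -!mulmxA Jx mulmx0 addr0 mul0mx.
  by rewrite [x *m _]mx11_scalar -dotE xx mulmx1.
move: E; rewrite a0 mul0mx add0r => /(canRL (mulmxKp fJ)).
by rewrite mul0mx => ->; apply: (@row_mx0 R 1 1 n).
Qed.

Lemma sphere_frame_orthogonal n (x v : 'rV[R]_n.+1) (J : 'M[R]_(n, n.+1)) :
  dot x x = 1 -> J *m x^T = 0 -> row_free J -> dot v x = 0 -> v *m J^T = 0 -> v = 0.
Proof.
move=> xx Jx fJ vx vJ; have uM := sphere_frame_unit xx Jx fJ.
have vM : v *m (col_mx x J : 'M[R]_n.+1)^T = 0.
  apply: (etrans (congr1 (mulmx v) (tr_col_mx x J))).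
  apply: (etrans (mul_mx_row _ _ _)); rewrite vJ [v *m _]mx11_scalar -dotE vx.
  by rewrite raddf0 row_mx0.
rewrite -unitmx_tr in uM.
by rewrite -[v](mulmxK uM) vM mul0mx.
Qed.

(** The row spaces of A J and J coincide. *)
Lemma normal_proj_mul k N (A : 'M[R]_k) (J : 'M[R]_(k, N)) v :
  A \in unitmx -> row_free J -> normal_proj (A *m J) v = normal_proj J v.
Proof.
move=> uA fJ; have uJ := row_free_gram_unit fJ.
rewrite /normal_proj; congr (_ - _).
rewrite (@invmx_uniq _ _ (A *m J *m _) (invmx A^T *m invmx (J *m J^T) *m invmx A)); last first.
  rewrite trmx_mul !mulmxA -(mulmxA A) ; move: (J *m J^T) uJ => G uG.
  by rewrite mulmxK ?unitmx_tr// mulmxK// mulmxV.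
by rewrite trmx_mul !mulmxA mulmxK ?unitmx_tr// mulmxKV.
Qed.

End ProductCoordinates.

(** * The two components of the mean curvature equation *)
Section NormalSplitting.
Variable R : realType.

(** With q = 1 + f1^2, the left-hand side is the mean curvature vector and the
    right-hand side is C times the normal part of the position vector, both in
    polar coordinates.  Pairing the second component with y gives the scalar
    equation and then B = - be y.  Conversely both components are multiples of
    x and y, and the two sides of the first one differ by - f1 times the scalar
    equation. *)
Lemma normal_splitting n m (x A : 'rV[R]_n) (y B : 'rV[R]_m) (r f0 f1 f2 al be q c0 C : R) :
  q != 0 -> q = 1 + f1 ^+ 2 -> f0 != 0 ->
  dot x x = 1 -> dot y y = 1 -> dot A x = - al -> dot B y = - be ->
  (B = - be *: y -> A = - al *: x) ->
  c0 = q^-1 * (q^-1 * (f2 * f1) - r * al - f0 * f1 * be) ->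
  q^-1 *: row_mx 0 (f2 *: y) - c0 *: row_mx x (f1 *: y) + row_mx (r *: A) (f0 *: B)
    = C *: (row_mx (r *: x) (f0 *: y) - (q^-1 * (r + f0 * f1)) *: row_mx x (f1 *: y))
  <-> B - dot B y *: y = 0 /\
      q^-1 * f2 - c0 * f1 - be * f0 + C * (r * f1 - f0) / q = 0.
Proof.
move=> q0 qE f00 xx yy Ax By AB c0E.
rewrite !scale_row_mx !opp_row_mx !add_row_mx scale_row_mx By scaler0 add0r scaleNr opprK.
split=> [/eq_row_mx[E1 E2]|[E1 E2]].
  have E : f0 *: B = (C * (f0 - q^-1 * (r + f0 * f1) * f1) - q^-1 * f2 + c0 * f1) *: y.
    apply: (addrI (q^-1 *: (f2 *: y) - c0 *: (f1 *: y))); rewrite E2.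
    rewrite !scalerA -!scalerBl scalerA -scalerDl; congr (_ *: _); ring.
  have Es : f0 * - be = C * (f0 - q^-1 * (r + f0 * f1) * f1) - q^-1 * f2 + c0 * f1.
    by rewrite -By -dotZl E dotZl yy mulr1.
  have EB : B = - be *: y.
    by apply: (scalerI f00); rewrite E -Es scalerA.
  split; first by rewrite EB scaleNr addNr.
  have qq : C * (f0 - q^-1 * (r + f0 * f1) * f1) = - (C * (r * f1 - f0) / q).
    rewrite qE in q0 *; field; exact: q0.
  move: Es; rewrite qq => Es.
  have : q^-1 * f2 - c0 * f1 - be * f0 + C * (r * f1 - f0) / q =
     f0 * - be - (- (C * (r * f1 - f0) / q) - q^-1 * f2 + c0 * f1) by ring.
  by rewrite Es subrr.
have EB : B = - be *: y by apply/eqP; rewrite scaleNr -addr_eq0 E1.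
rewrite (AB EB) EB !scalerA -!scalerBl -!scalerDl scalerA -?scaleNr -?scalerDl scalerA.
congr row_mx; congr (_ *: _).
  have := congr1 (fun z => f1 * z) E2; rewrite mulr0 c0E.
  rewrite qE in q0 *; move=> E; apply/eqP; rewrite -subr_eq0; apply/eqP.
  transitivity (- (f1 * ((1 + f1 ^+ 2)^-1 * f2
     - (1 + f1 ^+ 2)^-1 * ((1 + f1 ^+ 2)^-1 * (f2 * f1) - r * al - f0 * f1 * be) * f1
     - be * f0 + C * (r * f1 - f0) / (1 + f1 ^+ 2)))).
    by rewrite -[_ *: _]/(_ * _); field; exact: q0.
  by rewrite E oppr0.
apply/eqP; rewrite -subr_eq0 -E2; apply/eqP.
by rewrite qE in q0 *; rewrite -?[_ *: _]/(_ * _); field; exact: q0.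
Qed.

Lemma laplace_ode (r f0 f1 f2 al be q c0 C : R) :
  q != 0 -> q = 1 + f1 ^+ 2 ->
  c0 = q^-1 * (q^-1 * (f2 * f1) - r * al - f0 * f1 * be) ->
  q^-1 * f2 - c0 * f1 - be * f0 + C * (r * f1 - f0) / q =
  q^-1 * (f2 / q + (r * f1 * al - be * f0) + C * (r * f1 - f0)).
Proof. by move=> q0 qE ->; rewrite qE in q0 *; field; exact: q0. Qed.

End NormalSplitting.

(** * Polar coordinates on the spherical graph *)
Section CylindricalChart.
Variables (R : realType) (n m : nat) (f : R -> R).
Variables (Phi : 'rV[R]_n -> 'rV[R]_n.+1) (w : 'rV[R]_n -> 'rV[R]_m.+1).
Variable U : set 'rV[R]_n.
Hypothesis oU : open U.
Hypothesis CPhi : forall k, Ck k U Phi.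
Hypothesis Cw : forall k, Ck k U w.
Hypothesis SPhi : forall v, U v -> dot (Phi v) (Phi v) = 1.
Hypothesis Sw : forall v, U v -> dot (w v) (w v) = 1.
Hypothesis JPhi : forall v, U v -> row_free ('J Phi v).
Hypothesis Cf : forall k, Ck k [set t : R | 0 < t] (f : R -> R^o).
Hypothesis f_gt0 : forall t : R, 0 < t -> 0 < f t.

Definition slice (t : R) (v : 'rV[R]_n) : 'rV[R]_(n.+1 + m.+1) :=
  row_mx (t *: Phi v) (f t *: w v).

Definition cylF (p : 'rV[R]_(1 + n)) : 'rV[R]_(n.+1 + m.+1) :=
  slice (p 0 (lshift n 0)) (rsubmx p).

Lemma cyl_fst t (v : 'rV[R]_n) : cyl t v 0 (lshift n 0) = t.
Proof. by rewrite row_mxEl mxE. Qed.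

Lemma cylF_cyl t v : cylF (cyl t v) = slice t v.
Proof. by rewrite /cylF cyl_fst row_mxKr. Qed.

Lemma cylF_ray v : (fun t => cylF (cyl t v)) = slice^~ v.
Proof. by apply/funext => t; exact: cylF_cyl. Qed.

Lemma cylF_slice t : (fun v => cylF (cyl t v)) = slice t.
Proof. by apply/funext => v; exact: cylF_cyl. Qed.

Lemma Ck_slice k t : Ck k U (slice t).
Proof. exact: (Ck_row_mx oU (Ck_scalec t oU (CPhi k)) (Ck_scalec (f t) oU (Cw k))). Qed.

Let oP : open [set t : R | 0 < t].
Proof. exact: open_gt. Qed.

Let df (t : R) : 0 < t -> differentiable (f : R -> R^o) t.
Proof. by move=> t0; have [+ _] := Cf 1; apply. Qed.

(** Differentiate |h|^2 = 1. *)
Lemma derive_axis_sphere N (h : 'rV[R]_n -> 'rV[R]_N) : (forall k, Ck k U h) ->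
  (forall v, U v -> dot (h v) (h v) = 1) ->
  forall v i, U v -> dot (partial i h v) (h v) = 0.
Proof.
move=> Ch Sh v i Uv; have dh : differentiable h v by have [+ _] := Ch 1; apply.
have := derive_dot (delta_mx 0 i) dh dh.
rewrite (near_eq_derive (g := cst (1 : R^o))); last first.
  by apply: filterS (open_nbhs_nbhs (conj oU Uv)) => y /Sh.
rewrite derive_cst => /esym/eqP E; apply/eqP.
have : dot (partial i h v) (h v) *+ 2 == 0.
  by rewrite mulr2n [X in _ + X]dotC; exact: E.
by rewrite mulrn_eq0.
Qed.

(** Differentiate once more: the component of the second derivatives along h is
    minus the induced metric, so its trace is minus an energy. *)
Lemma dot_second_sphere N (h : 'rV[R]_n -> 'rV[R]_N) : (forall k, Ck k U h) ->
  (forall v, U v -> dot (h v) (h v) = 1) ->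
  forall v i j, U v -> dot (partial i (partial j h) v) (h v)
     = - dot (partial i h v) (partial j h v).
Proof.
move=> Ch Sh v i j Uv; have dh : differentiable h v by have [+ _] := Ch 1; apply.
have dh2 : differentiable (partial j h) v.
  by have [_ /(_ (delta_mx 0 j))[+ _]] := Ch 2; apply.
have := derive_dot (delta_mx 0 i) dh2 dh.
rewrite (near_eq_derive (g := cst (0 : R^o))); last first.
  by apply: filterS (open_nbhs_nbhs (conj oU Uv)) => y; exact: derive_axis_sphere.
rewrite derive_cst => /esym/eqP E; apply/eqP; rewrite -addr_eq0.
by rewrite [X in _ + X]dotC; exact: E.
Qed.

Let dPhi v : U v -> differentiable Phi v.
Proof. by have [+ _] := CPhi 1; apply. Qed.
Let dw v : U v -> differentiable w v.
Proof. by have [+ _] := Cw 1; apply. Qed.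
Let dslice t v : U v -> differentiable (slice t) v.
Proof. by have [+ _] := Ck_slice 1 t; apply. Qed.
Let dPhi2 i v : U v -> differentiable (partial i Phi) v.
Proof. by have [_ /(_ (delta_mx 0 i))[+ _]] := CPhi 2; apply. Qed.
Let dw2 i v : U v -> differentiable (partial i w) v.
Proof. by have [_ /(_ (delta_mx 0 i))[+ _]] := Cw 2; apply. Qed.

Lemma partial_slice t v i : U v ->
  partial i (slice t) v = row_mx (t *: partial i Phi v) (f t *: partial i w v).
Proof.
move=> Uv; rewrite /partial derive_row_mx; [|exact/differentiableZ/dPhi|
  exact/differentiableZ/dw|exact: dslice].
by rewrite !deriveZ//; [exact/diff_derivable/dw|exact/diff_derivable/dPhi].
Qed.

Lemma partial2_slice t v i j : U v ->
  partial i (partial j (slice t)) v =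
  row_mx (t *: partial i (partial j Phi) v) (f t *: partial i (partial j w) v).
Proof.
move=> Uv.
transitivity (partial i (fun v => row_mx (t *: partial j Phi v) (f t *: partial j w v)) v).
  apply: near_eq_derive; apply: filterS (open_nbhs_nbhs (conj oU Uv)) => y.
  exact: partial_slice.
rewrite /partial derive_row_mx; [|exact/differentiableZ/dPhi2|exact/differentiableZ/dw2|].
  by rewrite !deriveZ//; [exact/diff_derivable/dw2|exact/diff_derivable/dPhi2].
suff : Ck 1 U (fun v => row_mx (t *: partial j Phi v) (f t *: partial j w v)).
  by move=> [+ _]; apply.
exact: (Ck_row_mx oU (Ck_scalec t oU (Ck_partial j (CPhi 2)))
  (Ck_scalec (f t) oU (Ck_partial j (Cw 2)))).
Qed.

Let Cf1 k : Ck k [set t : R | 0 < t] (f^`()%classic : R -> R^o).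
Proof.
have [_ /(_ 1)] := Cf k.+1.
by rewrite (_ : (fun x => _) = f^`()%classic)//; apply/funext => t; rewrite derive1E.
Qed.

Let df1 (t : R) : 0 < t -> differentiable (f^`()%classic : R -> R^o) t.
Proof. by move=> t0; have [+ _] := Cf1 1; apply. Qed.

Lemma radial_slice t v : 0 < t ->
  (fun s => slice s v)^`()%classic t = row_mx (Phi v) (f^`()%classic t *: w v).
Proof.
move=> t0; rewrite derive1_row_mx.
- congr row_mx; last exact/derive1_scale/df.
  apply: (etrans (derive1_scale (a := id) _ _)); first exact: ex_diff.
  by rewrite derive1E derive_id scale1r.
- exact: differentiableZl.
- exact/differentiableZl/df.
suff : Ck 1 [set t : R | 0 < t] (fun s : R => row_mx (s *: Phi v) (f s *: w v)).
  by move=> [+ _]; apply.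
exact: (Ck_row_mx oP (Ck_scaler _ oP (Ck_id _ _)) (Ck_scaler _ oP (Cf 1))).
Qed.

Lemma radial2_slice t v : 0 < t ->
  (fun s => (fun s' => slice s' v)^`()%classic s)^`()%classic t =
  row_mx 0 (f^`(2)%classic t *: w v).
Proof.
move=> t0; transitivity ((fun s => row_mx (Phi v) (f^`()%classic s *: w v))^`()%classic t).
  rewrite !derive1E; apply: near_eq_derive.
  by apply: filterS (open_nbhs_nbhs (conj oP t0)) => s; exact: radial_slice.
rewrite derive1_row_mx.
- congr row_mx; first by rewrite derive1E derive_cst.
  exact/derive1_scale/df1.
- exact: differentiable_cst.
- exact/differentiableZl/df1.
suff : Ck 1 [set t : R | 0 < t] (fun s : R => row_mx (Phi v) (f^`()%classic s *: w v)).
  by move=> [+ _]; apply.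
exact: (Ck_row_mx oP (Ck_cst _ _ _) (Ck_scaler _ oP (Cf1 1))).
Qed.

Let V0 := [set p : 'rV[R]_(1 + n) | 0 < p 0 (lshift n 0) /\ U (rsubmx p)].

Let oV0 : open V0.
Proof.
apply: openI; first by apply: open_comp oP => p _; exact: coord_continuous.
by apply: open_comp oU => p _; exact: continuous_rsubmx.
Qed.

Lemma Ck_cylF k : Ck k V0 cylF.
Proof.
have Cr : Ck k V0 (rsubmx : 'rV[R]_(1 + n) -> 'rV[R]_n).
  exact: (Ck_lin oV0 (@continuous_rsubmx _ _ _ _) (Ck_id _ _)).
have Ca : Ck k V0 (fun p : 'rV[R]_(1 + n) => p 0 (lshift n 0) : R^o).
  exact: (Ck_coord _ _ oV0 (Ck_id _ _)).
have C1 := Ck_comp_rV oV0 (fun p pV => pV.2) Cr (CPhi k).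
have C2 := Ck_comp_rV oV0 (fun p pV => pV.2) Cr (Cw k).
have C3 := Ck_comp_R (U' := [set t : R | 0 < t]) oV0 (fun p pV => pV.1) Ca (Cf k).
exact: (Ck_row_mx oV0 (Ck_scale oV0 Ca C1) (Ck_scale oV0 C3 C2)).
Qed.

Section AtPoint.
Variables (r : R) (u : 'rV[R]_n).
Hypotheses (r0 : 0 < r) (Uu : U u).

Let f0 := f r.
Let f1 := f^`()%classic r.
Let f2 := f^`(2)%classic r.
Let q := 1 + f1 ^+ 2.
Let x := Phi u.
Let y := w u.
Let p := cyl r u.
Let J := 'J (slice r) u.
Let g := gram (slice r) u.
(* The radial tangent vector. *)
Let K0 : 'rV[R]_(n.+1 + m.+1) := row_mx x (f1 *: y).

(** The traces alpha and 2e with respect to g_r of the metrics induced by [Phi]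
    and by [w]; the second is twice the energy density of [w]. *)
Definition domain_trace : R := \tr (invmx (gram (slice r) u) *m gram Phi u).
Definition target_trace : R := \tr (invmx (gram (slice r) u) *m gram w u).

Let q0 : q != 0.
Proof. by rewrite gt_eqF// ltr_wpDr// sqr_ge0. Qed.

Let f00 : f0 != 0.
Proof. by rewrite gt_eqF// f_gt0. Qed.

Lemma cyl_domain : V0 p.
Proof. by split; rewrite /= /p ?cyl_fst ?row_mxKr. Qed.

Let dcylF : differentiable cylF p.
Proof. by have [+ _] := Ck_cylF 1; apply; exact: cyl_domain. Qed.

Lemma jacobian_slice : J = row_mx (r *: 'J Phi u) (f0 *: 'J w u).
Proof.
apply/row_matrixP => i; rewrite row_row_mx !linearZ/= /J.
by rewrite !jacobian_row ?partial_slice//; [exact: dw|exact: dPhi|exact: dslice].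
Qed.

Lemma row_free_slice : row_free J.
Proof.
apply: inj_row_free => v; rewrite jacobian_slice mul_mx_row => /eqP.
rewrite row_mx_eq0 => /andP[/eqP + _]; rewrite -scalemxAr => /eqP.
rewrite scaler_eq0 (gt_eqF r0) /= => /eqP vJ.
by move/(canRL (mulmxKp (JPhi Uu))): vJ; rewrite mul0mx.
Qed.

Lemma gram_slice : g = r ^+ 2 *: gram Phi u + f0 ^+ 2 *: gram w u.
Proof.
rewrite /g /gram -/J jacobian_slice tr_row_mx mul_row_col !linearZ/=.
by rewrite -!scalemxAl !scalerA -!expr2.
Qed.

Lemma gram_slice_unit : g \in unitmx.
Proof. exact/row_free_gram_unit/row_free_slice. Qed.

Let tPhi l : dot x (partial l Phi u) = 0.
Proof. by rewrite dotC; exact: derive_axis_sphere. Qed.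

Let tw l : dot y (partial l w u) = 0.
Proof. by rewrite dotC; exact: derive_axis_sphere. Qed.

(** The radial vector, the position vector and the radial second derivative all
    have this form, so they are normal to the slice; this is why the metric is
    block diagonal. *)
Lemma slice_normal a b : row_mx (a *: x) (b *: y) *m J^T = 0.
Proof.
apply/rowP => l; rewrite gramE_row row_id /J jacobian_row; last exact: dslice.
rewrite partial_slice// dot_row_mx !dotZl !dotZr tPhi tw.
by rewrite !mulr0 addr0 mxE.
Qed.

Lemma jacobian_cylF : 'J cylF p = col_mx K0 J.
Proof.
apply/row_matrixP => i; rewrite jacobian_row//; case: (split_ordP i) => l ->.
  rewrite rowKu row_id ord1 -[RHS](radial_slice u r0).
  apply: (etrans (partial_lshift _ _ _)).
  exact: (congr1 (fun k : R -> 'rV_(n.+1 + m.+1) => k^`()%classic r) (cylF_ray u)).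
rewrite rowKd jacobian_row; last exact: dslice.
apply: (etrans (partial_rshift _ _ _ _)).
exact: (congr1 (fun k => partial l k u) (cylF_slice r)).
Qed.

Let K0J : K0 *m J^T = 0.
Proof. by have := slice_normal 1 f1; rewrite scale1r. Qed.

Let K0K0 : dot K0 K0 = q.
Proof. by rewrite dot_row_mx dotZl dotZr (SPhi Uu) (Sw Uu) mulr1. Qed.

Lemma gram_cylF : gram cylF p = block_mx q%:M 0 0 g.
Proof.
rewrite /gram jacobian_cylF tr_col_mx mul_col_mx !mul_mx_row K0J.
rewrite -[J *m K0^T]trmxK trmx_mul trmxK K0J trmx0 /block_mx; congr col_mx.
by congr row_mx; rewrite [LHS]mx11_scalar -dotE K0K0.
Qed.

Let gram_cylF_unit : (block_mx q%:M 0 0 g : 'M[R]_(1 + n)) \in unitmx.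
Proof.
rewrite unitmxE det_ublock det_scalar1 unitrM unitfE q0 /= -unitmxE.
exact: gram_slice_unit.
Qed.

Lemma row_free_cylF : row_free ('J cylF p).
Proof.
apply/row_freeP; exists (('J cylF p)^T *m block_mx q^-1%:M 0 0 (invmx g)).
rewrite mulmxA -/(gram cylF p) gram_cylF -(invmx_block_scalar q0 gram_slice_unit).
exact: (mulmxV gram_cylF_unit).
Qed.

Let Yr := trace_metric g (fun i j => partial i (partial j (slice r)) u).
Let TPhi := trace_metric g (fun i j => partial i (partial j Phi) u).
Let Tw := trace_metric g (fun i j => partial i (partial j w) u).

Let YrE : Yr = row_mx (r *: TPhi) (f0 *: Tw).
Proof.
rewrite /Yr (eq_trace_metric _ (fun i j => partial2_slice r i j Uu)).
by rewrite trace_metric_row_mx !trace_metricZ.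
Qed.

Lemma dot_trace_second N (h : 'rV[R]_n -> 'rV[R]_N) : (forall k, Ck k U h) ->
  (forall v, U v -> dot (h v) (h v) = 1) ->
  dot (trace_metric g (fun i j => partial i (partial j h) u)) (h u)
  = - \tr (invmx g *m gram h u).
Proof.
move=> Ch Sh; have dh : differentiable h u by have [+ _] := Ch 1; apply.
rewrite dotE -trace_metric_mulmx summxE -[gram h u]gram_sym -trace_metric_mx -trace_metricN.
apply: eq_bigr => i _; rewrite summxE; apply: eq_bigr => j _.
rewrite mxE -dotE; congr (_ * _).
by rewrite (dot_second_sphere Ch Sh i j Uu) gramE_row !jacobian_row.
Qed.

Lemma trace_second_cylF :
  trace_metric (gram cylF p) (fun i j => partial i (partial j cylF) p)
  = q^-1 *: row_mx 0 (f2 *: y) + Yr.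
Proof.
rewrite gram_cylF; apply: (etrans (trace_metric_block _ q0 gram_slice_unit)).
apply: (congr2 (fun a b => q^-1 *: a + b)).
  rewrite -[RHS](radial2_slice u r0); apply: (etrans (partial2_lshift _ _ _)).
  exact: (congr1 (fun k : R -> 'rV_(n.+1 + m.+1) => (fun s => k^`()%classic s)^`()%classic r)
    (cylF_ray u)).
apply: eq_trace_metric => i j; apply: (etrans (partial2_rshift _ _ _ _ _)).
exact: (congr1 (fun k => partial i (partial j k) u) (cylF_slice r)).
Qed.

(* The radial component of the drift: the pairing of the trace of the second
   derivatives with K0, divided by the squared length q of K0. *)
Let c0 := q^-1 * (q^-1 * (f2 * f1) - r * domain_trace - f0 * f1 * target_trace).

Lemma drift_cylF : drift cylF p = row_mx c0%:M (drift (slice r) u).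
Proof.
rewrite /drift trace_second_cylF jacobian_cylF gram_cylF.
rewrite (invmx_block_scalar q0 gram_slice_unit).
rewrite tr_col_mx mul_mx_row mul_row_block !mulmx0 addr0 add0r; congr row_mx.
  rewrite mulmxDl mul_mx_scalar [X in _ *: X]mx11_scalar scale_scalar_mx; congr _%:M.
  rewrite /c0; congr (_ * _); rewrite mxE -scalemxAl mxE -!dotE.
  rewrite YrE !dot_row_mx !dotZl !dotZr dot0l add0r (Sw Uu) mulr1.
  rewrite (dot_trace_second CPhi SPhi) (dot_trace_second Cw Sw) -/domain_trace -/target_trace.
  by rewrite !mulrN addrA mulrA.
rewrite mulmxDl -scalemxAl.
have := slice_normal 0 f2; rewrite scale0r => ->.
by rewrite scaler0 add0r.
Qed.

(** Since the metric is block diagonal, only the radial part of the drift is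
    added to lap on the slice. *)
Lemma lap_cylF (W : normedModType R) (h : 'rV[R]_(1 + n) -> W) :
  lap cylF h p =
  q^-1 *: (fun s => (fun s' => h (cyl s' u))^`()%classic s)^`()%classic r
  - c0 *: (fun s => h (cyl s u))^`()%classic r
  + lap (slice r) (fun v => h (cyl r v)) u.
Proof.
rewrite /lap drift_cylF gram_cylF.
apply: (etrans (congr1 (fun a => a - _) (trace_metric_block _ q0 gram_slice_unit))).
rewrite (@big_split_ord _ _ _ 1 n) big_ord1 /= row_mxEl mxE eqxx mulr1n opprD addrACA.
apply: (congr2 +%R (congr2 (fun a b => q^-1 *: a - c0 *: b) _ _) (congr2 (fun a b => a - b) _ _)).
- exact: partial2_lshift.
- exact: partial_lshift.
- by apply: eq_trace_metric => i j; exact: partial2_rshift.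
- by apply: eq_bigr => l _; rewrite row_mxEr; congr (_ *: _); exact: partial_rshift.
Qed.

Let A := lap (slice r) Phi u.
Let B := lap (slice r) w u.

Lemma lap_slice : lap (slice r) (slice r) u = row_mx (r *: A) (f0 *: B).
Proof.
rewrite /A /B /lap -/g -/Yr YrE -/TPhi -/Tw !scalerBr -add_row_mx -opp_row_mx.
congr (_ - _).
have E l : drift (slice r) u 0 l *: partial l (slice r) u =
    row_mx (r *: (drift (slice r) u 0 l *: partial l Phi u))
           (f0 *: (drift (slice r) u 0 l *: partial l w u)).
  rewrite partial_slice// scale_row_mx; congr row_mx; first by rewrite !scalerA mulrC.
  by rewrite !scalerA mulrC.
rewrite (eq_bigr _ (fun l _ => E l)) !scaler_sumr.
by elim/big_rec3: _ => [|l a b c _ ->]; rewrite ?row_mx0 ?add_row_mx.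
Qed.

(** lap of an immersion applied to itself is normal. *)
Lemma lap_slice_normal : row_mx (r *: A) (f0 *: B) *m J^T = 0.
Proof.
have dE : \sum_l drift (slice r) u 0 l *: partial l (slice r) u = drift (slice r) u *m J.
  by rewrite mulmx_jacobian//; exact: dslice.
rewrite -lap_slice; apply: (etrans (congr1 (fun z => (_ - z) *m J^T) dE)).
rewrite mulmxBl -mulmxA -/g /drift -/g -/J mulmxKV ?gram_slice_unit//.
by rewrite subrr.
Qed.

Let Ax : dot A x = - domain_trace.
Proof.
rewrite /A /lap dotBl (dot_trace_second CPhi SPhi) dot_suml big1 ?subr0// => l _.
by rewrite dotZl dotC tPhi mulr0.
Qed.

Let By : dot B y = - target_trace.
Proof.
rewrite /B /lap dotBl (dot_trace_second Cw Sw) dot_suml big1 ?subr0// => l _.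
by rewrite dotZl dotC tw mulr0.
Qed.

Let JPhix : 'J Phi u *m x^T = 0.
Proof.
apply/matrixP => i j; rewrite gramE_row jacobian_row; last exact: dPhi.
by rewrite ord1 row_id dotC tPhi mxE.
Qed.

(* B + 2e y = 0 kills the second summand of the normality relation
   r^2 <A, d_l Phi> + f^2 <B, d_l w> = 0, so A is a multiple of x. *)
Let AB : B = - target_trace *: y -> A = - domain_trace *: x.
Proof.
move=> BE; apply/eqP; rewrite scaleNr -addr_eq0; apply/eqP.
apply: (sphere_frame_orthogonal (SPhi Uu) JPhix (JPhi Uu)).
  by rewrite dotDl dotZl (SPhi Uu) Ax mulr1 addNr.
apply/rowP => l; rewrite gramE_row row_id jacobian_row; last exact: dPhi.
rewrite dotDl dotZl tPhi mulr0 addr0 mxE.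
have := congr1 (fun z : 'rV_n => z 0 l) lap_slice_normal.
rewrite /= gramE_row row_id /J jacobian_row; last exact: dslice.
rewrite partial_slice// dot_row_mx BE scalerA !dotZl !dotZr tw !mulr0 addr0 mxE.
move/eqP; rewrite mulf_eq0 (gt_eqF r0) /= mulf_eq0 (gt_eqF r0) /= => /eqP.
by [].
Qed.

Lemma mean_curvature_cylF :
  lap cylF cylF p = q^-1 *: row_mx 0 (f2 *: y) - c0 *: row_mx x (f1 *: y)
    + row_mx (r *: A) (f0 *: B).
Proof.
apply: (etrans (lap_cylF cylF)).
apply: (congr2 +%R (congr2 (fun a b => q^-1 *: a - c0 *: b) _ _) _).
- rewrite -[RHS](radial2_slice u r0).
  exact: (congr1 (fun k : R -> 'rV_(n.+1 + m.+1) => (fun s => k^`()%classic s)^`()%classic r)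
    (cylF_ray u)).
- rewrite -[RHS](radial_slice u r0).
  exact: (congr1 (fun k : R -> 'rV_(n.+1 + m.+1) => k^`()%classic r) (cylF_ray u)).
- rewrite -lap_slice.
  exact: (congr1 (fun k => lap (slice r) k u) (cylF_slice r)).
Qed.

Lemma normal_proj_cylF :
  normal_proj ('J cylF p) (cylF p) =
  row_mx (r *: x) (f0 *: y) - (q^-1 * (r + f0 * f1)) *: row_mx x (f1 *: y).
Proof.
rewrite cylF_cyl /normal_proj; congr (_ - _).
have := gram_cylF; rewrite /gram => ->; rewrite jacobian_cylF.
rewrite (invmx_block_scalar q0 gram_slice_unit).
rewrite tr_col_mx mul_mx_row mul_row_block !mulmx0 addr0 add0r.
rewrite (_ : slice r u *m J^T = 0); last exact: slice_normal.
rewrite mul0mx mul_row_col mul0mx addr0 mul_mx_scalar -scalemxAl.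
rewrite [_ *m K0^T]mx11_scalar -dotE mul_scalar_mx scalerA; congr (_ * _ *: _).
by rewrite dot_row_mx !dotZl !dotZr (SPhi Uu) (Sw Uu) !mulr1.
Qed.

(** The function f on the spherical graph, in polar coordinates. *)
Definition height (p : 'rV[R]_(1 + n)) : R^o := f (p 0 (lshift n 0)).

Lemma lap_height : lap cylF height p = q^-1 * f2 - c0 * f1.
Proof.
have hE v : (fun s => height (cyl s v)) = f.
  by apply/funext => s; rewrite /height cyl_fst.
have sE : (fun v => height (cyl r v)) = cst f0.
  by apply/funext => v; rewrite /height cyl_fst.
have l0 : lap (slice r) (cst f0 : 'rV[R]_n -> R^o) u = 0.
  have d0 : forall i v, partial i (cst f0 : 'rV[R]_n -> R^o) v = 0.
    by move=> i v; exact: derive_cst.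
  have d00 : forall i j, partial i (partial j (cst f0 : 'rV[R]_n -> R^o)) u = 0.
    move=> i j; rewrite (_ : partial j _ = cst (0 : R^o)); first exact: derive_cst.
    by apply/funext => v; exact: d0.
  rewrite /lap [X in X - _](_ : _ = 0) ?sub0r.
    by rewrite big1 ?oppr0// => l _; rewrite d0 scaler0.
  by rewrite /trace_metric big1// => i _; rewrite big1// => j _; rewrite d00 scaler0.
apply: (etrans (lap_cylF height)); rewrite -[RHS]addr0.
apply: (congr2 +%R (congr2 (fun a b => q^-1 * a - c0 * b) _ _) _).
- exact: (congr1 (fun k : R -> R^o => (fun s => k^`()%classic s)^`()%classic r) (hE u)).
- exact: (congr1 (fun k : R -> R^o => k^`()%classic r) (hE u)).
- rewrite -l0; exact: (congr1 (fun k : 'rV[R]_n -> R^o => lap (slice r) k u) sE).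
Qed.

Theorem mean_curvature_equation (C : R) :
  lap cylF cylF p = C *: normal_proj ('J cylF p) (cylF p) <->
  tension (gram (slice r)) w u = 0 /\
  lap cylF height p - target_trace * f0 + C * (r * f1 - f0) / q = 0.
Proof.
rewrite mean_curvature_cylF normal_proj_cylF lap_height.
rewrite (@tensionE _ _ _ _ (slice r) U u w (conj oU Uu) (Ck_slice 2 r)); last first.
  by move=> l; rewrite dotC tw.
exact: (@normal_splitting R _ _ x A y B r f0 f1 f2 domain_trace target_trace q c0 C
  q0 erefl f00 (SPhi Uu) (Sw Uu) Ax By AB erefl).
Qed.

Theorem height_equation (C : R) :
  lap cylF height p - target_trace * f0 + C * (r * f1 - f0) / q =
  q^-1 * (f2 / q + (r * f1 * domain_trace - target_trace * f0) + C * (r * f1 - f0)).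
Proof. by rewrite lap_height; exact: laplace_ode. Qed.

End AtPoint.

End CylindricalChart.

(** * The spherical graph as a graph over the punctured space *)
Section Locality.
Variable R : realType.

Lemma near_eq_jacobian k N (h g : 'rV[R]_k -> 'rV[R]_N) u :
  (\forall v \near u, h v = g v) -> differentiable h u -> 'J h u = 'J g u.
Proof.
move=> hg dh; have dg := near_eq_differentiable hg dh.
apply/row_matrixP => i; apply: (etrans (jacobian_row i dh)).
apply: (etrans _ (esym (jacobian_row i dg))).
exact: (near_eq_derive _ hg).
Qed.

Lemma lap_eq_on k N (V : normedModType R) (Psi Psi' : 'rV[R]_k -> 'rV[R]_N)
    (W W' : 'rV[R]_k -> V) U u :
  open_nbhs u U -> differentiable Psi u ->
  (forall v, U v -> Psi v = Psi' v) -> (forall v, U v -> W v = W' v) ->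
  lap Psi W u = lap Psi' W' u.
Proof.
move=> [oU Uu] dP eP eW.
have nU v : U v -> \forall y \near v, U y by move=> Uv; exact: open_nbhs_nbhs.
have d1 (V' : normedModType R) (X X' : 'rV[R]_k -> V') (i : 'I_k) v :
    (forall v, U v -> X v = X' v) -> U v -> partial i X v = partial i X' v.
  by move=> eX Uv; apply: near_eq_derive; apply: filterS (nU v Uv) => y; exact: eX.
have d2 (V' : normedModType R) (X X' : 'rV[R]_k -> V') (i j : 'I_k) :
    (forall v, U v -> X v = X' v) -> partial i (partial j X) u = partial i (partial j X') u.
  by move=> eX; apply: (d1 _ _ _ _ _ _ Uu) => v Uv; exact: (d1 _ _ _ _ _ eX Uv).
have eJ : 'J Psi u = 'J Psi' u.
  by apply: near_eq_jacobian => //; apply: filterS (nU u Uu) => y; exact: eP.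
have eg : gram Psi u = gram Psi' u by rewrite /gram eJ.
have ed : drift Psi u = drift Psi' u.
  have eT := eq_trace_metric (gram Psi u) (fun i j => d2 _ _ _ i j eP).
  by apply: (etrans (congr1 (fun T => T *m _ *m _) eT)); rewrite eJ eg.
have eT := eq_trace_metric (gram Psi u) (fun i j => d2 _ _ _ i j eW).
apply: (etrans (congr1 (fun T => T - _) eT)); rewrite ed eg.
apply: (congr1 (fun T => _ - T)); apply: eq_bigr => l _.
exact: (congr1 (fun T => _ *: T) (d1 _ _ _ _ _ eW Uu)).
Qed.

Lemma open_preimage_Ck (V W : normedModType R) (A : set V) (B : set W) (h : V -> W) :
  open A -> Ck 0 A h -> open B -> open (A `&` h @^-1` B).
Proof.
move=> oA hC oB; rewrite openE => v [Av Bv]; apply: filterI.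
  exact: open_nbhs_nbhs.
by apply: (hC v Av); exact: open_nbhs_nbhs.
Qed.

Lemma jacobian_id k (u : 'rV[R]_k) : 'J (@id 'rV[R]_k) u = 1%:M.
Proof.
apply/row_matrixP => i; rewrite jacobian_row; last exact: ex_diff.
by rewrite /partial derive_id rowE mulmx1.
Qed.

End Locality.

Section PolarCoordinates.
Variable R : realType.
Variable N : nat.
Implicit Types y x : 'rV[R]_N.

Definition enorm y : R := Num.sqrt (dot y y).
Definition normalize y : 'rV[R]_N := (enorm y)^-1 *: y.
Definition punctured : set 'rV[R]_N := [set y | y != 0].

Lemma open_punctured : open punctured.
Proof.
rewrite (_ : punctured = (fun y => `|y|) @^-1` [set t : R | t != 0]); last first.
  by apply/funext => y; rewrite /punctured /= normr_eq0.
apply: open_comp; last exact: open_neq.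
by move=> y _; exact: norm_continuous.
Qed.

Lemma enorm_gt0 y : y != 0 -> 0 < enorm y.
Proof. by move=> y0; rewrite sqrtr_gt0 dot_gt0. Qed.

Lemma Ck_enorm k : Ck k punctured (enorm : 'rV[R]_N -> R^o).
Proof.
have Cd : Ck k punctured (fun y => dot y y : R^o).
  exact: (Ck_dot open_punctured (Ck_id _ _) (Ck_id _ _)).
have pos y : punctured y -> [set t : R^o | 0 < t] (dot y y) by exact: dot_gt0.
exact: (Ck_comp_R open_punctured pos Cd (@Ck_sqrt R k)).
Qed.

Lemma Ck_normalize k : Ck k punctured normalize.
Proof.
have nz y : punctured y -> [set t : R^o | t != 0] (enorm y).
  by move=> y0; rewrite /= gt_eqF ?enorm_gt0.
have Ci := Ck_comp_R open_punctured nz (Ck_enorm k) (@Ck_inv R k).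
exact: (Ck_scale open_punctured Ci (Ck_id _ _)).
Qed.

Lemma dot_normalize y : y != 0 -> dot (normalize y) (normalize y) = 1.
Proof.
move=> y0; rewrite dotZl dotZr mulrA -invfM -expr2 sqr_sqrtr ?dot_ge0//.
by rewrite mulVf// gt_eqF ?dot_gt0.
Qed.

Lemma enorm_normalize y : y != 0 -> enorm y *: normalize y = y.
Proof. by move=> y0; rewrite scalerA mulfV ?scale1r// gt_eqF ?enorm_gt0. Qed.

Lemma enormZ r x : 0 <= r -> dot x x = 1 -> enorm (r *: x) = r.
Proof.
by move=> r0 xx; rewrite /enorm dotZl dotZr xx mulr1 -expr2 sqrtr_sqr ger0_norm.
Qed.

Lemma normalizeZ r x : 0 < r -> dot x x = 1 -> normalize (r *: x) = x.
Proof.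
move=> r0 xx; rewrite /normalize enormZ ?ltW// scalerA mulVf ?scale1r//.
by rewrite gt_eqF.
Qed.

Lemma unit_neq0 x : dot x x = 1 -> x != 0.
Proof.
by move=> xx; apply/eqP => x0; move: xx; rewrite x0 dot0l => /eqP; rewrite eq_sym oner_eq0.
Qed.

End PolarCoordinates.

Section GraphChart.
Variables (R : realType) (n m : nat) (f : R -> R) (L : 'rV[R]_n.+1 -> 'rV[R]_m.+1).
Hypothesis f_smooth : smooth_on [set r : R | 0 <= r] f.
Hypothesis L_smooth : smooth_on (@sphere R n) L.

Lemma Ck_f k : Ck k [set t : R | 0 < t] (f : R -> R^o).
Proof.
apply: smooth_on_open; first exact: open_gt.
move=> t /= /ltW /f_smooth[U [h [oU Ut Ch eh]]].
by exists U, h; split => // s Us /ltW; exact: eh.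
Qed.

(** The extension of L to the punctured space that is homogeneous of degree 0;
    it is smooth although L itself is arbitrary off the sphere. *)
Definition Lext (y : 'rV[R]_n.+1) : 'rV[R]_m.+1 := L (normalize y).

Lemma Ck_Lext k : Ck k (@punctured R n.+1) Lext.
Proof.
apply: Ck_local => y y0.
have [U [h [oU Uy Ch eh]]] := L_smooth (dot_normalize y0).
pose A := @punctured R n.+1 `&` @normalize R n.+1 @^-1` U.
have oA : open A by apply: open_preimage_Ck oU; [exact: open_punctured|exact: Ck_normalize].
exists A; first by split.
have CN : Ck k A (@normalize R n.+1).
  exact: (Ck_sub (@subIsetl _ _ _) (@Ck_normalize R n.+1 k)).
have AU z : A z -> U (normalize z) by case.
apply: (Ck_eq oA _ (Ck_comp_rV oA AU CN (Ch k))) => z [z0 Uz].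
by rewrite /= /Lext eh//; exact: dot_normalize.
Qed.

Definition fnorm (y : 'rV[R]_n.+1) : R^o := f (enorm y).

Lemma Ck_fnorm k : Ck k (@punctured R n.+1) fnorm.
Proof.
have pos y : @punctured R n.+1 y -> [set t : R | 0 < t] (enorm y) by exact: enorm_gt0.
exact: (Ck_comp_R (@open_punctured R n.+1) pos (@Ck_enorm R n.+1 k) (Ck_f k)).
Qed.

Definition graph (y : 'rV[R]_n.+1) : 'rV[R]_(n.+1 + m.+1) := row_mx y (fnorm y *: Lext y).

Lemma Ck_graph k : Ck k (@punctured R n.+1) graph.
Proof.
have oP := @open_punctured R n.+1.
exact: (Ck_row_mx oP (Ck_id _ _) (Ck_scale oP (Ck_fnorm k) (Ck_Lext k))).
Qed.

Lemma graph_polar r x : 0 < r -> sphere x -> graph (r *: x) = graphF f L r x.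
Proof.
by move=> r0 xS; rewrite /graph /fnorm /Lext enormZ ?ltW// normalizeZ.
Qed.

Lemma Sigma_graph p : Sigma f L p -> lsubmx p != 0 -> p = graph (lsubmx p).
Proof.
move=> [r [x [r0 xS ->]]]; rewrite row_mxKl scaler_eq0 negb_or => /andP[rn0 _].
by rewrite graph_polar// lt_neqAle eq_sym rn0.
Qed.

Lemma graph_Sigma y : y != 0 -> Sigma f L (graph y).
Proof.
move=> y0; exists (enorm y), (normalize y); split.
- exact/ltW/enorm_gt0.
- exact: dot_normalize.
- rewrite -[in LHS](enorm_normalize y0) graph_polar//; first exact: enorm_gt0.
  exact: dot_normalize.
Qed.

Let dgraph y : y != 0 -> differentiable graph y.
Proof. by have [+ _] := Ck_graph 1; apply. Qed.

Lemma row_free_graph y : y != 0 -> row_free ('J graph y).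
Proof.
move=> y0; apply/row_freeP; exists ('J (lsubmx : 'rV[R]_(n.+1 + m.+1) -> 'rV[R]_n.+1) (graph y)).
rewrite -jacobian_comp; [|exact: dgraph|exact: differentiable_lsubmx].
rewrite -[RHS](jacobian_id y); congr ('J _ y).
by apply/funext => z; rewrite /= row_mxKl.
Qed.

Lemma local_param_graph : local_param (Sigma f L) (@punctured R n.+1) graph.
Proof.
have oP := @open_punctured R n.+1.
split=> //.
- by apply: Ck_smooth_on => // k; exact: Ck_graph.
- exact: row_free_graph.
- by move=> y z _ _ /(congr1 lsubmx); rewrite !row_mxKl.
move=> V oV VP; exists (lsubmx @^-1` V); split.
  by apply: open_comp oV => z _; exact: continuous_lsubmx.
apply/seteqP; split=> [_ [y Vy <-]|p [pS pV]].
  by split; [exact/graph_Sigma/VP|rewrite /= row_mxKl].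
by exists (lsubmx p) => //; rewrite -Sigma_graph//; exact: VP.
Qed.

(** Around a point off the axis, a parametrization Psi factors through the graph
    by its own first component phi.  As the rows of 'J Psi = 'J phi *m 'J graph
    are independent, 'J phi is invertible and invariance applies. *)
Section Reparametrization.
Variables (U : set 'rV[R]_n.+1) (Psi : 'rV[R]_n.+1 -> 'rV[R]_(n.+1 + m.+1)) (u : 'rV[R]_n.+1).
Hypothesis oU : open U.
Hypothesis Uu : U u.
Hypothesis CPsi : forall k, Ck k U Psi.
Hypothesis PsiS : forall v, U v -> Sigma f L (Psi v).
Hypothesis free : row_free ('J Psi u).
Hypothesis phi0 : lsubmx (Psi u) != 0.

Let phi v := lsubmx (Psi v).

Let A := U `&` phi @^-1` (@punctured R n.+1).

Let Cphi k : Ck k U phi.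
Proof. exact: (Ck_lin oU (@continuous_lsubmx _ _ _ _) (CPsi k)). Qed.

Let oA : open_nbhs u A.
Proof. by split; [exact: (open_preimage_Ck oU (Cphi 0) (@open_punctured R n.+1))|split]. Qed.

Let PsiE v : A v -> Psi v = graph (phi v).
Proof. by move=> [Uv v0]; apply: Sigma_graph => //; exact: PsiS. Qed.

Let dPsi : differentiable Psi u.
Proof. by have [+ _] := CPsi 1; apply. Qed.

Let dphi : differentiable phi u.
Proof. by have [+ _] := Cphi 1; apply. Qed.

Let JPsi : 'J Psi u = 'J phi u *m 'J graph (phi u).
Proof.
apply: (etrans (near_eq_jacobian _ dPsi) (jacobian_comp dphi (dgraph phi0))).
by apply: filterS (open_nbhs_nbhs oA) => v; exact: PsiE.
Qed.

Let uphi : 'J phi u \in unitmx.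
Proof.
rewrite -row_free_unit; apply: inj_row_free => v vJ.
have : v *m 'J Psi u = 0 by rewrite JPsi mulmxA vJ mul0mx.
by move/(canRL (mulmxKp free)); rewrite mul0mx.
Qed.

Lemma lap_reparametrization (W : normedModType R) (X : 'rV[R]_n.+1 -> W)
    (X' : 'rV[R]_n.+1 -> W) :
  Ck 2 (@punctured R n.+1) X -> (forall v, A v -> X' v = X (phi v)) ->
  lap Psi X' u = lap graph X (phi u).
Proof.
move=> CX eX; rewrite (lap_eq_on oA dPsi PsiE eX).
apply: (lap_comp oA (U' := @punctured R n.+1)) => //.
- by move=> v [].
- exact: (Ck_sub (@subIsetl _ _ _) (Cphi 2)).
- exact: Ck_graph.
- exact/row_free_gram_unit/row_free_graph.
Qed.

Lemma lap_reparametrization_self : lap Psi Psi u = lap graph graph (phi u).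
Proof. by apply: lap_reparametrization => //; exact: Ck_graph. Qed.

Lemma normal_proj_reparametrization v :
  normal_proj ('J Psi u) v = normal_proj ('J graph (phi u)) v.
Proof.
apply: (etrans (congr1 (fun M => normal_proj M v) JPsi)).
exact: (normal_proj_mul v uphi (row_free_graph phi0)).
Qed.

End Reparametrization.

End GraphChart.

(** * Charts of the sphere *)
Lemma local_param_mem (R : realType) k N (S : set 'rV[R]_N) (U : set 'rV[R]_k) Phi u :
  local_param S U Phi -> U u -> S (Phi u).
Proof.
move=> [oU _ _ _ img] Uu; have [W [_ E]] := img U oU (@subset_refl _ U).
have : (Phi @` U) (Phi u) by exists u.
by rewrite E => -[].
Qed.

Lemma local_param_Ck (R : realType) k N (S : set 'rV[R]_N) (U : set 'rV[R]_k) Phi j :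
  local_param S U Phi -> Ck j U Phi.
Proof. by move=> [oU sP _ _ _]; exact: smooth_on_open. Qed.

Lemma local_param_row_free (R : realType) k N (S : set 'rV[R]_N) (U : set 'rV[R]_k) Phi u :
  local_param S U Phi -> U u -> row_free ('J Phi u).
Proof. by move=> [_ _ fJ _ _]; exact: fJ. Qed.

Section SphereChart.
Variables (R : realType) (n m : nat) (f : R -> R) (L : 'rV[R]_n.+1 -> 'rV[R]_m.+1).
Hypothesis f_smooth : smooth_on [set r : R | 0 <= r] f.
Hypothesis L_smooth : smooth_on (@sphere R n) L.
Hypothesis L_sphere : forall x, @sphere R n x -> @sphere R m (L x).
Hypothesis f_gt0 : forall r : R, 0 < r -> 0 < f r.

Section OneChart.
Variables (U : set 'rV[R]_n) (Phi : 'rV[R]_n -> 'rV[R]_n.+1).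
Hypothesis chart : local_param (@sphere R n) U Phi.

Let oU : open U. Proof. by case: chart. Qed.
Let CPhi k : Ck k U Phi. Proof. exact: local_param_Ck chart. Qed.
Let SPhi v : U v -> dot (Phi v) (Phi v) = 1.
Proof. by move=> Uv; exact: (local_param_mem chart Uv). Qed.
Let JPhi v : U v -> row_free ('J Phi v). Proof. by case: chart => _ _ + _ _; exact. Qed.

Lemma Lext_sphere x : sphere x -> Lext L x = L x.
Proof. by move=> xS; rewrite /Lext -[x in normalize x]scale1r normalizeZ. Qed.

Let PhiP v : U v -> @punctured R n.+1 (Phi v).
Proof. by move=> Uv; exact: unit_neq0 (SPhi Uv). Qed.

Let w := L \o Phi.

Lemma Ck_chart_target k : Ck k U w.
Proof.
apply: (Ck_eq oU _ (Ck_comp_rV oU PhiP (CPhi k) (Ck_Lext L_smooth k))) => v Uv.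
by rewrite /= Lext_sphere//; exact: SPhi.
Qed.

Let Cw := Ck_chart_target.

Let Sw v : U v -> dot (w v) (w v) = 1.
Proof. by move=> Uv; apply: L_sphere; exact: SPhi. Qed.

Let Cf := Ck_f f_smooth.

(** The target map is the restriction of a map defined near the sphere, so its
    differential in a chart is a linear image of that of the chart; this is what
    compares two charts at a common point in [singular_fractions]. *)
Lemma jacobian_target u : U u -> 'J w u = 'J Phi u *m 'J (Lext L) (Phi u).
Proof.
move=> Uu.
have dPhi : differentiable Phi u by have [+ _] := CPhi 1; apply.
have dL : differentiable (Lext L) (Phi u).
  by have [+ _] := Ck_Lext L_smooth 1; apply; exact: PhiP.
apply: (etrans _ (jacobian_comp dPhi dL)); apply: near_eq_jacobian.
  apply: filterS (open_nbhs_nbhs (conj oU Uu)) => v Uv.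
  by rewrite /= Lext_sphere//; exact: SPhi.
by have [+ _] := Cw 1; apply.
Qed.

Section AtPoint.
Variables (r : R) (u : 'rV[R]_n).
Hypotheses (r0 : 0 < r) (Uu : U u).

Let V0 := [set p : 'rV[R]_n.+1 | 0 < (p : 'rV[R]_(1 + n)) 0 (lshift n 0)
  /\ U (rsubmx (p : 'rV[R]_(1 + n)))].
Let Psi : 'rV[R]_n.+1 -> 'rV[R]_(n.+1 + m.+1) := cylF f Phi w.
Let p : 'rV[R]_n.+1 := cyl r u.

Let oV0 : open V0.
Proof.
apply: (@openI _ [set p : 'rV[R]_(1 + n) | 0 < p 0 (lshift n 0)] (rsubmx @^-1` U)).
  by apply: open_comp (@open_gt R 0) => z _; exact: coord_continuous.
by apply: open_comp oU => z _; exact: continuous_rsubmx.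
Qed.

Let V0p : V0 p. Proof. exact: (cyl_domain r0 Uu). Qed.

Let CPsi k : Ck k V0 Psi. Proof. exact: (Ck_cylF oU CPhi Cw Cf k). Qed.

Let PsiS v : V0 v -> Sigma f L (Psi v).
Proof.
move=> [v0 Uv]; exists ((v : 'rV[R]_(1 + n)) 0 (lshift n 0)), (Phi (rsubmx (v : 'rV[R]_(1 + n)))).
by split; [exact: ltW|exact: SPhi|].
Qed.

Let free : row_free ('J Psi p).
Proof. exact: (row_free_cylF oU CPhi Cw SPhi Sw JPhi Cf r0 Uu). Qed.

Let PsiE : lsubmx (Psi p) = r *: Phi u.
Proof. by rewrite /Psi /p cylF_cyl row_mxKl. Qed.

Let phi0 : lsubmx (Psi p) != 0.
Proof. by rewrite PsiE scaler_eq0 negb_or gt_eqF//=; exact: PhiP. Qed.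

Let PsiG : Psi p = graph f L (r *: Phi u).
Proof. by rewrite -PsiE; apply: Sigma_graph => //; exact: PsiS. Qed.

Let lapG : lap Psi Psi p = lap (graph f L) (graph f L) (r *: Phi u).
Proof.
by rewrite -PsiE; exact: (lap_reparametrization_self f_smooth L_smooth oV0 V0p CPsi PsiS free phi0).
Qed.

Let lapf : lap Psi (height f : 'rV[R]_n.+1 -> R^o) p = lap (graph f L) (fnorm f) (r *: Phi u).
Proof.
rewrite -PsiE.
refine (@lap_reparametrization _ _ _ _ _ f_smooth L_smooth _ _ _ oV0 V0p CPsi PsiS free phi0
  _ _ _ (@Ck_fnorm R n f f_smooth 2) _).
move=> v [[v0 Uv] _]; rewrite /fnorm /Psi /cylF /slice row_mxKl.
by rewrite (enormZ (ltW v0) (SPhi Uv)).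
Qed.

Let npG : normal_proj ('J Psi p) (Psi p) =
  normal_proj ('J (graph f L) (r *: Phi u)) (graph f L (r *: Phi u)).
Proof.
rewrite -PsiG -PsiE.
exact: (normal_proj_reparametrization f_smooth L_smooth oV0 V0p CPsi PsiS free phi0).
Qed.

(** Twice the energy density; see [energy_trace]. *)
Definition slice_energy : R := target_trace f Phi (L \o Phi) r u.

(** The equation H = C F^perp on the graph, at the point r x, split along the
    two factors by means of polar coordinates. *)
Lemma graph_equation C :
  lap (graph f L) (graph f L) (r *: Phi u) =
    C *: normal_proj ('J (graph f L) (r *: Phi u)) (graph f L (r *: Phi u))
  <-> tension (gram (graphF f L r \o Phi)) (L \o Phi) u = 0 /\
      lap (graph f L) (fnorm f) (r *: Phi u) - slice_energy * f r
        + C * (r * f^`()%classic r - f r) / (1 + f^`()%classic r ^+ 2) = 0.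
Proof.
rewrite -lapG -npG -lapf.
exact: (mean_curvature_equation oU CPhi Cw SPhi Sw JPhi Cf f_gt0 r0 Uu C).
Qed.

Lemma graph_height_equation C :
  lap (graph f L) (fnorm f) (r *: Phi u) - slice_energy * f r
        + C * (r * f^`()%classic r - f r) / (1 + f^`()%classic r ^+ 2) =
  (1 + f^`()%classic r ^+ 2)^-1 *
       (f^`(2)%classic r / (1 + f^`()%classic r ^+ 2) +
        (r * f^`()%classic r * domain_trace f Phi (L \o Phi) r u - slice_energy * f r) +
        C * (r * f^`()%classic r - f r)).
Proof.
rewrite -lapf.
exact: (height_equation oU CPhi Cw SPhi Sw JPhi Cf r0 Uu C).
Qed.

Lemma gram_graphF : gram (graphF f L r \o Phi) u =
  r ^+ 2 *: gram Phi u + f r ^+ 2 *: gram (L \o Phi) u.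
Proof. exact: (@gram_slice R n m f Phi w U oU CPhi Cw r u Uu). Qed.

Lemma row_free_graphF : row_free ('J (graphF f L r \o Phi) u).
Proof. exact: (@row_free_slice R n m f Phi w U oU CPhi Cw JPhi r u r0 Uu). Qed.

(** The rows of E being orthonormal, E^T E is the inverse metric. *)
Lemma energy_trace (E : 'M[R]_n) :
  E *m gram (graphF f L r \o Phi) u *m E^T = 1%:M ->
  \sum_(i < n) dot (row i E *m 'J (L \o Phi) u) (row i E *m 'J (L \o Phi) u) = slice_energy.
Proof.
move=> EE; rewrite /slice_energy /target_trace (invmx_orthonormal EE) -mulmxA mxtrace_mulC.
apply: eq_bigr => i _; rewrite -!row_mul -gramE_row /gram trmx_mul !mulmxA.
by [].
Qed.

Lemma energy_exists : exists E : 'M[R]_n, E *m gram (graphF f L r \o Phi) u *m E^T = 1%:M.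
Proof.
by apply: posdef_orthonormal; [exact: gram_sym|exact/posdef_gram/row_free_graphF].
Qed.

End AtPoint.
End OneChart.

(** By invariance, every parametrization through p gives the value computed on
    the graph. *)
Lemma laplacian_atE p v : lsubmx p != 0 ->
  laplacian_at n.+1 (Sigma f L) (f_Sigma f) p v -> v = lap (graph f L) (fnorm f) (lsubmx p).
Proof.
move=> p0 [U [Psi [u [chart Uu Psip ->]]]].
have CPsi k : Ck k U Psi := local_param_Ck k chart.
have oU : open U by case: chart.
rewrite (laplace_beltramiE (f_Sigma f \o Psi) (conj oU Uu) (CPsi 2)) -Psip in p0 *.
refine (@lap_reparametrization _ _ _ _ _ f_smooth L_smooth _ _ _ oU Uu CPsi _ _ p0
  _ _ _ (@Ck_fnorm R n f f_smooth 2) _).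
- by move=> u' Uu'; exact: (local_param_mem chart Uu').
- by case: chart => _ _ + _ _; exact.
by [].
Qed.

Lemma laplacian_at_graph y : y != 0 ->
  laplacian_at n.+1 (Sigma f L) (f_Sigma f) (graph f L y) (lap (graph f L) (fnorm f) y).
Proof.
move=> y0; exists (@punctured R n.+1), (graph f L), y; split => //.
  exact: local_param_graph.
have oy : open_nbhs y (@punctured R n.+1) by split => //; exact: open_punctured.
rewrite (laplace_beltramiE _ oy (Ck_graph f_smooth L_smooth 2)); congr (lap _ _ y).
by apply/funext => z; rewrite /fnorm /= /f_Sigma row_mxKl.
Qed.

End SphereChart.

(** * Existence of charts of the sphere *)
Section TangentSpace.
Variable R : realType.

Lemma rank_kermx_vector n (x : 'rV[R]_n.+1) : x != 0 -> \rank (kermx x^T) = n.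
Proof.
move=> x0; rewrite mxrank_ker mxrank_tr.
by have -> : \rank x = 1%N; [rewrite rank_rV x0|rewrite subn1].
Qed.

Lemma hyperplane_span n (x : 'rV[R]_n.+1) (J : 'M[R]_(n, n.+1)) k (z : 'M[R]_(k, n.+1)) :
  x != 0 -> J *m x^T = 0 -> row_free J -> z *m x^T = 0 -> (z <= J)%MS.
Proof.
move=> x0 /sub_kermxP Jx fJ /sub_kermxP zx; apply: (submx_trans zx).
by rewrite -(mxrank_leqif_sup Jx) (eqP fJ) rank_kermx_vector.
Qed.

Lemma hyperplane_basis n (x : 'rV[R]_n.+1) : x != 0 ->
  exists J : 'M[R]_(n, n.+1), J *m x^T = 0 /\ row_free J.
Proof.
move=> x0; suff : exists J : 'M[R]_(\rank (kermx x^T), n.+1), J *m x^T = 0 /\ row_free J.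
  by rewrite rank_kermx_vector.
exists (row_base (kermx x^T)); split; last exact: row_base_free.
by apply/sub_kermxP; rewrite eq_row_base.
Qed.

(** Central projection of the affine hyperplane x + x^perp to the open
    hemisphere around x.  Its inverse y |-> y / <y, x> - x, in the coordinates
    of a basis B of x^perp, is smooth where <y, x> > 0; this gives independence
    of the partial derivatives, injectivity and openness at once. *)
Lemma sphere_chart_exists n (x : 'rV[R]_n.+1) : sphere x ->
  exists (U : set 'rV[R]_n) (Phi : 'rV[R]_n -> 'rV[R]_n.+1) (u : 'rV[R]_n),
    [/\ local_param (@sphere R n) U Phi, U u & Phi u = x].
Proof.
move=> xx; have x0 := unit_neq0 xx.
have [B [Bx fB]] := hyperplane_basis x0.
pose aff (v : 'rV[R]_n) := x + v *m B.
have affx v : dot (aff v) x = 1.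
  by rewrite dotDl xx (dotE (v *m B)) -mulmxA Bx mulmx0 mxE addr0.
have aff0 v : aff v != 0.
  by apply/eqP => E; have := affx v; rewrite E dot0l => /eqP; rewrite eq_sym oner_eq0.
pose Phi v := normalize (aff v).
pose chartinv (y : 'rV[R]_n.+1) : 'rV[R]_n := ((dot y x)^-1 *: y - x) *m pinvmx B.
pose A := [set y : 'rV[R]_n.+1 | 0 < dot y x].
have Cdot k (S : set 'rV[R]_n.+1) : open S -> Ck k S (fun y => dot y x : R^o).
  by move=> oS; exact: (Ck_dot oS (Ck_id _ _) (Ck_cst _ _ _)).
have oA : open A.
  have := open_preimage_Ck openT (Cdot 0 _ openT) (@open_gt R 0).
  by rewrite setTI.
have oT := @openT 'rV[R]_n.
have CPhi k : Ck k setT Phi.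
  have Ca : Ck k setT aff.
    exact: (CkD oT (Ck_cst _ _ _) (Ck_mulmx oT (Ck_id _ _) (Ck_cst _ _ _))).
  exact: (Ck_comp_rV oT (fun v _ => aff0 v) Ca (@Ck_normalize R n.+1 k)).
have Cinv k : Ck k A chartinv.
  have nz y : A y -> [set t : R^o | t != 0] (dot y x) by move=> /gt_eqF/negbT.
  have Ci := Ck_comp_R oA nz (Cdot k A oA) (@Ck_inv R k).
  have Cs := CkD oA (Ck_scale oA Ci (Ck_id _ _)) (Ck_cst k A (- x)).
  exact: (Ck_mulmx oA Cs (Ck_cst _ _ _)).
have Phix v : dot (Phi v) x = (enorm (aff v))^-1 by rewrite dotZl affx mulr1.
have APhi v : A (Phi v) by rewrite /A /= Phix invr_gt0 enorm_gt0.
have PhiK v : chartinv (Phi v) = v.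
  rewrite /chartinv Phix invrK enorm_normalize// /aff addrAC subrr add0r.
  exact: mulmxKp.
have chartinvK y : sphere y -> A y -> Phi (chartinv y) = y.
  move=> yy Ay; rewrite /Phi /aff /chartinv mulmxKpV; last first.
    apply: (hyperplane_span x0 Bx fB); rewrite mulmxBl -scalemxAl.
    rewrite [y *m _]mx11_scalar [x *m _]mx11_scalar -!dotE xx scale_scalar_mx.
    by rewrite mulVf ?subrr// gt_eqF.
  by rewrite addrCA subrr addr0 normalizeZ// invr_gt0.
exists setT, Phi, 0; split=> //; last first.
  by rewrite /Phi /aff mul0mx addr0 -[X in normalize X]scale1r normalizeZ.
split=> //.
- by apply: Ck_smooth_on => // k; exact: CPhi.
- move=> v _; apply/row_freeP; exists ('J chartinv (Phi v)).
  have dP : differentiable Phi v by have [+ _] := CPhi 1; apply.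
  have dI : differentiable chartinv (Phi v) by have [+ _] := Cinv 1; apply; exact: APhi.
  rewrite -(jacobian_comp dP dI) -[RHS](jacobian_id v).
  by congr ('J _ v); apply/funext => z; exact: PhiK.
- by move=> v v' _ _ E; rewrite -(PhiK v) E PhiK.
move=> V oV _; exists (A `&` chartinv @^-1` V); split.
  exact: (open_preimage_Ck oA (Cinv 0) oV).
apply/seteqP; split=> [_ [v Vv <-]|y [yS [Ay Vy]]].
  by split; [exact: dot_normalize|split; [exact: APhi|rewrite /= PhiK]].
by exists (chartinv y) => //; exact: chartinvK.
Qed.

End TangentSpace.

(** * Singular values *)
Section Fractions.
Variables (R : realType) (n m : nat) (f : R -> R) (L : 'rV[R]_n.+1 -> 'rV[R]_m.+1).
Hypothesis f_smooth : smooth_on [set r : R | 0 <= r] f.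
Hypothesis L_smooth : smooth_on (@sphere R n) L.
Hypothesis f_gt0 : forall r : R, 0 < r -> 0 < f r.

(** With M = H G^-1 one has r^2 G + s^2 H = (r^2 + s^2 M) G, so the first trace
    is that of the inverse of r^2 + s^2 M; the second one follows because the
    combination of both with weights r^2 and s^2 is the dimension. *)
Lemma trace_fractions k (G H : 'M[R]_k) (mu : 'I_k -> R) (r s c : R) :
  G \in unitmx -> 0 < r -> 0 < s -> (forall i, 0 <= mu i) ->
  char_poly (H *m invmx G) = \prod_i ('X - (mu i)%:P) ->
  c * \tr (invmx (r ^+ 2 *: G + s ^+ 2 *: H) *m G)
   - \tr (invmx (r ^+ 2 *: G + s ^+ 2 *: H) *m H) * s
  = \sum_i (c - mu i * s) / (r ^+ 2 + mu i * s ^+ 2).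
Proof.
move=> uG r0 s0 mu0 cM; set M := H *m invmx G in cM.
have s20 : s ^+ 2 != 0 by rewrite expf_neq0// gt_eqF.
have nz i : r ^+ 2 + s ^+ 2 * mu i != 0.
  by rewrite gt_eqF// ltr_pwDl ?exprn_gt0// mulr_ge0// sqr_ge0.
set g := r ^+ 2 *: G + s ^+ 2 *: H; pose A := (r ^+ 2)%:M + s ^+ 2 *: M.
have gE : g = A *m G.
  by rewrite /g /A mulmxDl mul_scalar_mx -scalemxAl /M mulmxKV.
have uA : A \in unitmx.
  rewrite unitmxE (det_affine cM _ s20) unitfE; apply/prodf_neq0 => i _; exact: nz.
have ig : invmx g = invmx G *m invmx A.
  by apply: invmx_uniq; rewrite gE mulmxA mulmxK// mulmxV.
have alE : \tr (invmx g *m G) = \sum_i (r ^+ 2 + s ^+ 2 * mu i)^-1.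
  rewrite ig mxtrace_mulC mulmxA mulmxV// mul1mx.
  exact: (trace_inv_affine s20 cM nz).
have tot : r ^+ 2 * \tr (invmx g *m G) + s ^+ 2 * \tr (invmx g *m H) = k%:R.
  rewrite -!mxtraceZ -linearD /= -!linearZ -linearD /= -/g mulVmx ?mxtrace1//.
  by rewrite gE unitmx_mul uA.
have beE : \tr (invmx g *m H) = \sum_i mu i / (r ^+ 2 + s ^+ 2 * mu i).
  apply: (mulfI s20); apply: (addrI (r ^+ 2 * \tr (invmx g *m G))); rewrite tot alE.
  rewrite !mulr_sumr -big_split /=.
  have -> : k%:R = \sum_(i < k) (1 : R) by rewrite sumr_const card_ord.
  by apply: eq_bigr => i _; rewrite mulrA -mulrDl mulfV.
rewrite alE beE mulr_sumr mulr_suml -sumrB; apply: eq_bigr => i _.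
by rewrite [_ / _ * s]mulrAC -mulrBl [mu i * s ^+ 2]mulrC.
Qed.

(** The singular values come with a chart Phi' of their own.  Both charts have
    the same tangent space at the common point, so there is an invertible P with
    'J Phi = P 'J Phi', and the same P relates the differentials of L; the traces
    are invariant under this change of basis. *)
Lemma singular_fractions (U : set 'rV[R]_n) (Phi : 'rV[R]_n -> 'rV[R]_n.+1) u r
    (lam : 'I_n -> R) :
  local_param (@sphere R n) U Phi -> U u -> 0 < r ->
  singular_values_at (@sphere R n) L (Phi u) lam ->
  forall c, c * domain_trace f Phi (L \o Phi) r u - slice_energy f L Phi r u * f r
  = \sum_(i < n) (c - lam i ^+ 2 * f r) / (r ^+ 2 + lam i ^+ 2 * f r ^+ 2).
Proof.
move=> chart Uu r0 [U' [Phi' [u' [chart' Uu' xE lam0 cM]]]] c.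
have gE := gram_graphF f L_smooth chart r Uu.
have gE' := gram_graphF f L_smooth chart' r Uu'.
have tangent (V : set 'rV[R]_n) Psi v : local_param (@sphere R n) V Psi -> V v ->
    'J Psi v *m (Psi v)^T = 0.
  move=> ch Vv; apply/matrixP => i j; rewrite gramE_row jacobian_row; last first.
    by have [+ _] := local_param_Ck 1 ch; apply.
  rewrite ord1 row_id mxE; apply: (derive_axis_sphere (U := V)) => //.
  - by case: ch.
  - by move=> k; exact: local_param_Ck ch.
  - by move=> y Vy; exact: (local_param_mem ch Vy).
have Jx := tangent _ _ _ chart Uu; have Jx' := tangent _ _ _ chart' Uu'.
have fJ : row_free ('J Phi u) by exact: (local_param_row_free chart Uu).
have fJ' : row_free ('J Phi' u') by exact: (local_param_row_free chart' Uu').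
rewrite xE in Jx'.
have x0 : Phi u != 0 by exact: unit_neq0 (local_param_mem chart Uu).
pose P := 'J Phi u *m pinvmx ('J Phi' u').
have JE : 'J Phi u = P *m 'J Phi' u'.
  exact/esym/(mulmxKpV (hyperplane_span x0 Jx' fJ' Jx)).
have uP : P \in unitmx.
  rewrite -row_free_unit; apply: inj_row_free => v vP.
  have : v *m 'J Phi u = 0 by rewrite JE mulmxA vP mul0mx.
  by move/(canRL (mulmxKp fJ)); rewrite mul0mx.
have JwE : 'J (L \o Phi) u = P *m 'J (L \o Phi') u'.
  rewrite (jacobian_target L_smooth chart Uu) (jacobian_target L_smooth chart' Uu') xE.
  by rewrite JE mulmxA.
have GE : gram Phi u = P *m gram Phi' u' *m P^T.
  by rewrite /gram JE trmx_mul !mulmxA.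
have HE : gram (L \o Phi) u = P *m gram (L \o Phi') u' *m P^T.
  by rewrite /gram JwE trmx_mul !mulmxA.
have ug' : gram (graphF f L r \o Phi') u' \in unitmx.
  by apply: row_free_gram_unit; apply: (row_free_graphF _ L_smooth chart' r0 Uu').
have gg : gram (graphF f L r \o Phi) u = P *m gram (graphF f L r \o Phi') u' *m P^T.
  rewrite gE gE' GE HE; move: (gram Phi' u') (gram _ u') => G H.
  by rewrite mulmxDr mulmxDl -!scalemxAr -!scalemxAl.
rewrite /slice_energy /domain_trace /target_trace.
rewrite -![slice f _ (L \o _) r]/(graphF f L r \o _) gg {1}GE HE !mxtrace_congr// gE'.
apply: trace_fractions => //.
- exact: row_free_gram_unit.
- exact: f_gt0.
- by move=> i; exact: sqr_ge0.
Qed.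

End Fractions.

(** * Points on the axis *)
Section Continuity.
Variables (R : realType) (V : normedModType R).

Lemma Ck_prod k (U : set V) (I : Type) (s : seq I) (h : I -> V -> R^o) : open U ->
  (forall i, Ck k U (h i)) -> Ck k U (fun x => \prod_(i <- s) h i x : R^o).
Proof.
move=> oU hC; elim: s => [|i s IH].
  by apply: (Ck_eq oU _ (Ck_cst k U (1 : R^o))) => x _; rewrite big_nil.
by apply: (Ck_eq oU _ (CkM oU (hC i) IH)) => x _; rewrite big_cons.
Qed.

Lemma Ck_det k p (U : set V) (A : V -> 'M[R]_p) : open U ->
  Ck k U A -> Ck k U (fun x => \det (A x) : R^o).
Proof.
move=> oU CA; apply: Ck_sum => // s; apply: CkM => //; first exact: Ck_cst.
by apply: Ck_prod => // i; exact: Ck_coord.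
Qed.

Lemma Ck_invmx k p (U : set V) (A : V -> 'M[R]_p) : open U ->
  (forall x, U x -> A x \in unitmx) -> Ck k U A -> Ck k U (fun x => invmx (A x)).
Proof.
move=> oU uA CA.
have nz x : U x -> [set t : R^o | t != 0] (\det (A x)).
  by move=> /uA; rewrite unitmxE unitfE.
have Cd := Ck_comp_R oU nz (Ck_det oU CA) (@Ck_inv R k).
have Cadj : Ck k U (fun x => \adj (A x)).
  apply: Ck_mx => // i j.
  have Cc : Ck k U (fun x => cofactor (A x) j i : R^o).
    apply: CkM => //; first exact: Ck_cst.
    apply: Ck_det => //; apply: Ck_mx => // a b.
    by apply: (Ck_eq oU _ (Ck_coord (lift j a) (lift i b) oU CA)) => x _; rewrite !mxE.
  by apply: (Ck_eq oU _ Cc) => x _; rewrite mxE.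
apply: (Ck_eq oU _ (Ck_scale oU Cd Cadj)) => x /uA uAx.
by rewrite /invmx uAx.
Qed.

End Continuity.

Lemma Ck_normal_proj (R : realType) k j N (U : set 'rV[R]_k) (J : 'rV[R]_k -> 'M[R]_(k, N))
    (v : 'rV[R]_k -> 'rV[R]_N) :
  open U -> (forall u, U u -> row_free (J u)) -> Ck j U J -> Ck j U v ->
  Ck j U (fun u => normal_proj (J u) (v u)).
Proof.
move=> oU fJ CJ Cv; have CJT := Ck_trmx oU CJ.
have Cg := Ck_invmx oU (fun u Uu => row_free_gram_unit (fJ u Uu)) (Ck_mulmx oU CJ CJT).
exact: (CkD oU Cv (CkN oU (Ck_mulmx oU (Ck_mulmx oU (Ck_mulmx oU Cv CJT) Cg) CJ))).
Qed.

Lemma Ck_mean_curvature (R : realType) k j N (U : set 'rV[R]_k) (Psi : 'rV[R]_k -> 'rV[R]_N) :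
  open U -> (forall u, U u -> row_free ('J Psi u)) -> Ck j.+2 U Psi ->
  Ck j U (mean_curvature Psi).
Proof.
move=> oU fJ CPsi; have CJ := Ck_jacobian oU (CkS CPsi).
have Cg := Ck_invmx oU (fun u Uu => row_free_gram_unit (fJ u Uu))
  (Ck_mulmx oU CJ (Ck_trmx oU CJ)).
apply: (Ck_sum _ oU) => a; apply: (Ck_sum _ oU) => b.
exact: (Ck_scale oU (Ck_coord a b oU Cg)
  (Ck_normal_proj oU fJ CJ (Ck_partial a (Ck_partial b CPsi)))).
Qed.

Section SelfSimilar.
Variables (R : realType) (n m : nat) (f : R -> R) (L : 'rV[R]_n.+1 -> 'rV[R]_m.+1) (C : R).
Hypothesis f_smooth : smooth_on [set r : R | 0 <= r] f.
Hypothesis L_smooth : smooth_on (@sphere R n) L.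
Hypothesis L_sphere : forall x, @sphere R n x -> @sphere R m (L x).
Hypothesis f_gt0 : forall r : R, 0 < r -> 0 < f r.

(** A point (0, f(0) L(x)) of the axis is the limit of the points
    (s x, f(s) L(x)) of Sigma as s decreases to 0. *)
Lemma Sigma_axis_approx (O : set 'rV[R]_(n.+1 + m.+1)) p :
  open O -> O p -> Sigma f L p -> exists q, [/\ O q, Sigma f L q & lsubmx q != 0].
Proof.
move=> oO Op [r [x [r0 xS pE]]].
have [rgt0|rle0] := ltP 0 r.
  exists p; split=> //; first by exists r, x.
  by rewrite pE row_mxKl scaler_eq0 negb_or gt_eqF//=; exact: unit_neq0.
have rE : r = 0 by apply/eqP; rewrite eq_le rle0.
(* f is only assumed smooth on the closed half-line, so the ray is continued to
   negative s by a local extension h of f. *)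
have [W [h [oW W0 Ch eh]]] := f_smooth (lexx 0 : [set r : R | 0 <= r] 0).
have Cray : Ck 0 W (fun s : R => row_mx (s *: x) (h s *: L x)).
  exact: (Ck_row_mx oW (Ck_scaler _ oW (Ck_id _ _)) (Ck_scaler _ oW (Ch 0%N))).
have oI := open_preimage_Ck oW Cray oO.
have I0 : \forall s \near (0 : R), (W `&` (fun s : R => row_mx (s *: x) (h s *: L x)) @^-1` O) s.
  apply: open_nbhs_nbhs; split => //; split => //=.
  by rewrite -eh//=; move: Op; rewrite pE rE.
have [e /= e0 eP] := (@nbhs_ballP R _ 0 _).1 I0.
have e20 : 0 < e / 2 by rewrite divr_gt0.
have [We Oe] : (W `&` (fun s : R => row_mx (s *: x) (h s *: L x)) @^-1` O) (e / 2).
  apply: eP; rewrite /ball /= sub0r normrN gtr0_norm//.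
  by rewrite ltr_pdivrMr// ltr_pMr// ltr1n.
exists (graphF f L (e / 2) x); split.
- by move: Oe; rewrite /= -eh//= ltW.
- by exists (e / 2), x; split => //; exact: ltW.
- by rewrite row_mxKl scaler_eq0 negb_or gt_eqF//=; exact: unit_neq0.
Qed.

(** * The equivalences *)

(** The equation H = C F^perp at the point of the graph over y. *)
Definition graph_self_similar (y : 'rV[R]_n.+1) : Prop :=
  lap (graph f L) (graph f L) y = C *: normal_proj ('J (graph f L) y) (graph f L y).

(** At a point of the axis, the difference Z of the two sides is continuous.
    If it were nonzero there, it would be nonzero on an open set, whose image is
    relatively open in Sigma and therefore contains a point off the axis. *)
Lemma self_similar_graph :
  self_similar n.+1 (Sigma f L) C <-> forall y, y != 0 -> graph_self_similar y.
Proof.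
split=> [H y y0|H U Psi chart u Uu].
  rewrite /graph_self_similar -mean_curvatureE; last first.
    by have [+ _] := Ck_graph f_smooth L_smooth 1; apply.
  exact: (H _ _ (local_param_graph f_smooth L_smooth) y y0).
have oU : open U by case: chart.
have CPsi k : Ck k U Psi := local_param_Ck k chart.
have fJ v : U v -> row_free ('J Psi v) := local_param_row_free chart.
have dPsi v : U v -> differentiable Psi v by have [+ _] := CPsi 1; apply.
have regular v : U v -> lsubmx (Psi v) != 0 ->
    mean_curvature Psi v = C *: normal_proj ('J Psi v) (Psi v).
  move=> Uv v0; rewrite (mean_curvatureE (dPsi v Uv)).
  have PS w : U w -> Sigma f L (Psi w) := local_param_mem chart.
  rewrite (lap_reparametrization_self f_smooth L_smooth oU Uv CPsi PS (fJ v Uv) v0).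
  rewrite (normal_proj_reparametrization f_smooth L_smooth oU Uv CPsi PS (fJ v Uv) v0).
  by rewrite [X in normal_proj _ X](Sigma_graph (PS v Uv) v0); exact: H.
pose Z v := mean_curvature Psi v - C *: normal_proj ('J Psi v) (Psi v).
have CZ : Ck 0 U Z.
  apply: (CkD oU (Ck_mean_curvature oU fJ (CPsi 2))).
  apply: (CkN oU); apply: (Ck_scalec C oU).
  exact: (Ck_normal_proj oU fJ (Ck_jacobian oU (CPsi 1)) (CPsi 0%N)).
apply/eqP; rewrite -subr_eq0 -/(Z u); apply/negPn/negP => Zu.
have oV := open_preimage_Ck oU CZ (@open_punctured R (n.+1 + m.+1)).
have [_ _ _ _ img] := chart.
have [T [oT TE]] := img _ oV (@subIsetl _ _ _).
have [SPu TPu] : (Sigma f L `&` T) (Psi u) by rewrite -TE; exists u.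
have [q [Tq Sq q0]] := Sigma_axis_approx oT TPu SPu.
have : (Sigma f L `&` T) q by [].
rewrite -TE => -[v [Uv Zv] vq].
by move: Zv; rewrite /punctured /= /Z regular ?subrr ?eqxx// vq.
Qed.

Lemma self_similar_iff_conditions :
  self_similar n.+1 (Sigma f L) C <-> harmonic_condition f L /\ laplace_condition f L C.
Proof.
split=> [/self_similar_graph H|[harm lapc]].
  split=> [r r0 U Phi chart u Uu|r r0 x xS lap e lapP].
    have y0 : r *: Phi u != 0.
      by rewrite scaler_eq0 negb_or gt_eqF//=; exact: unit_neq0 (local_param_mem chart Uu).
    by have [+ _] := (graph_equation f_smooth L_smooth L_sphere f_gt0 chart r0 Uu C).1 (H _ y0).
  have y0 : r *: x != 0 by rewrite scaler_eq0 negb_or gt_eqF//=; exact: unit_neq0.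
  have l0 : lsubmx (graphF f L r x) = r *: x by rewrite row_mxKl.
  have -> := laplacian_atE f_smooth L_smooth (p := graphF f L r x) _ lapP; last by rewrite l0.
  move=> [U [Phi [u [E [chart Uu Phix EE ->]]]]].
  have := ((graph_equation f_smooth L_smooth L_sphere f_gt0 chart r0 Uu C).1 _).2.
  rewrite Phix l0 => /(_ (H _ y0)) E0; rewrite -[RHS]E0.
  by rewrite (energy_trace EE) mulrA mulfV// mul1r.
apply/self_similar_graph => y y0.
have [U [Phi [u [chart Uu Phix]]]] := sphere_chart_exists (dot_normalize y0).
have r0 := enorm_gt0 y0; set r := enorm y in r0.
have yE : y = r *: Phi u by rewrite Phix enorm_normalize.
rewrite yE; apply/(graph_equation f_smooth L_smooth L_sphere f_gt0 chart r0 Uu C).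
split; first exact: (harm r r0 U Phi chart u Uu).
have [E EE] := energy_exists f L_smooth chart r0 Uu.
have := lapc r r0 (Phi u) (local_param_mem chart Uu) _ (2^-1 * slice_energy f L Phi r u).
move=> /(_ (lap (graph f L) (fnorm f) (r *: Phi u))).
rewrite mulrA mulfV// mul1r; apply.
  rewrite -(graph_polar f L r0 (local_param_mem chart Uu)) -yE.
  exact: laplacian_at_graph.
by exists U, Phi, u, E; split => //; rewrite (energy_trace EE).
Qed.

Lemma laplace_condition_iff_ode (lam : 'rV[R]_n.+1 -> 'I_n -> R) :
  (forall x, @sphere R n x -> singular_values_at (@sphere R n) L x (lam x)) ->
  laplace_condition f L C <->
  forall (r : R) (x : 'rV[R]_n.+1), 0 < r -> @sphere R n x ->
    f^`(2)%classic r / (1 + f^`()%classic r ^+ 2)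
    + \sum_(i < n) (r * f^`()%classic r - lam x i ^+ 2 * f r)
                         / (r ^+ 2 + lam x i ^+ 2 * f r ^+ 2)
    + C * (r * f^`()%classic r - f r) = 0.
Proof.
move=> lamP.
have q0 r : 1 + f^`()%classic r ^+ 2 != 0 by rewrite gt_eqF// ltr_wpDr// sqr_ge0.
have ode U Phi u r : local_param (@sphere R n) U Phi -> U u -> 0 < r ->
   lap (graph f L) (fnorm f) (r *: Phi u) - slice_energy f L Phi r u * f r
        + C * (r * f^`()%classic r - f r) / (1 + f^`()%classic r ^+ 2) = 0 <->
   f^`(2)%classic r / (1 + f^`()%classic r ^+ 2)
    + \sum_(i < n) (r * f^`()%classic r - lam (Phi u) i ^+ 2 * f r)
                         / (r ^+ 2 + lam (Phi u) i ^+ 2 * f r ^+ 2)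
    + C * (r * f^`()%classic r - f r) = 0.
  move=> chart Uu r0.
  rewrite (graph_height_equation f_smooth L_smooth L_sphere chart r0 Uu C).
  have sv := lamP _ (local_param_mem chart Uu).
  rewrite (singular_fractions L_smooth f_gt0 chart Uu r0 sv).
  split=> [/eqP|->]; last by rewrite mulr0.
  by rewrite mulf_eq0 invr_eq0 (negbTE (q0 r)) => /eqP.
split=> [H r x r0 xS|H r r0 x xS lap e lapP].
  have [U [Phi [u [chart Uu Phix _ _]]]] := lamP x xS.
  rewrite -Phix; apply/(ode U) => //.
  have [E EE] := energy_exists f L_smooth chart r0 Uu.
  have := H r r0 (Phi u) (local_param_mem chart Uu) _ (2^-1 * slice_energy f L Phi r u).
  move=> /(_ (lap (graph f L) (fnorm f) (r *: Phi u))).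
  rewrite mulrA mulfV// mul1r; apply.
    rewrite -(graph_polar f L r0 (local_param_mem chart Uu)).
    apply: laplacian_at_graph => //.
    by rewrite scaler_eq0 negb_or gt_eqF//=; exact: unit_neq0 (local_param_mem chart Uu).
  by exists U, Phi, u, E; split => //; rewrite (energy_trace EE).
have l0 : lsubmx (graphF f L r x) = r *: x by rewrite row_mxKl.
have -> := laplacian_atE f_smooth L_smooth (p := graphF f L r x) _ lapP; last first.
  by rewrite l0 scaler_eq0 negb_or gt_eqF//=; exact: unit_neq0.
move=> [U [Phi [u [E [chart Uu Phix EE ->]]]]].
have := H r x r0 xS; rewrite -Phix => /(ode U Phi u r chart Uu r0) E0.
by rewrite -[RHS]E0 (energy_trace EE) mulrA mulfV// mul1r row_mxKl.
Qed.

End SelfSimilar.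

Unset Implicit Arguments.

Theorem theorem3p1 (R : realType) (n m : nat) (f : R -> R)
    (L : 'rV[R]_n.+1 -> 'rV[R]_m.+1) (C : R)
    (f_smooth : smooth_on [set r : R | 0 <= r] f)
    (L_smooth : smooth_on (@sphere R n) L)
    (L_sphere : forall x, @sphere R n x -> @sphere R m (L x))
    (f_gt0 : forall r : R, 0 < r -> 0 < f r)
    (C_pm1 : C = 1 \/ C = -1) :
  (self_similar n.+1 (Sigma f L) C <->
     harmonic_condition f L /\ laplace_condition f L C)
  /\
  (forall lam : 'rV[R]_n.+1 -> 'I_n -> R,
     (forall x, @sphere R n x ->
        singular_values_at (@sphere R n) L x (lam x)) ->
     (laplace_condition f L C <->
        forall (r : R) (x : 'rV[R]_n.+1), 0 < r -> @sphere R n x ->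
          f^`(2)%classic r / (1 + f^`()%classic r ^+ 2)
          + \sum_(i < n) (r * f^`()%classic r - lam x i ^+ 2 * f r)
                         / (r ^+ 2 + lam x i ^+ 2 * f r ^+ 2)
          + C * (r * f^`()%classic r - f r) = 0)).
Proof.
split; first exact: self_similar_iff_conditions.
by move=> lam; exact: laplace_condition_iff_ode.
Qed.
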